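(* There is an absolute constant $K>0$ such that the following holds. Let $n\ge2$, let $A\in\mathbb{R}^{n\times n}$ be symmetric with zero diagonal, let $\lambda>0$ with $\lambda\ge\max_i\sum_j|A_{ij}|$, let $p_1,\dots,p_n\in[0,1)$ be known with $p_{\max}=\max_ip_i$, and let $\epsilon>0$, $\delta\in(0,1)$. Suppose $$T\ge\max\left\{16\log(2n-1),\ K\,\epsilon^{-4}(1-p_{\max})^{-4}\exp\Big(\big(\tfrac{2}{1-p_{\max}}+10\big)\lambda\Big)\log\frac n\delta\right\}$$ and run the missing-data SMG algorithm with $T$ iterations and step size $\eta=\frac{(1-p_{\max})^2}{2}\exp\big(-\frac{\lambda}{1-p_{\max}}\big)\sqrt{\frac{\log(2n-1)}{T}}$. Then with probability at least $1-\delta$ its output $\bar w$ satisfies $$\big|\bar w_i-\bar w_{n-1+i}-A_{ni}\big|\le\epsilon\quad\text{for all } i\in[n-1].$$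
   Context: Ising model $\mathcal{D}=\mathcal{D}(A,0)$ on $\{-1,1\}^n$: $\Pr[Z=z]\propto\exp\big(\sum_{i<j}A_{ij}z_iz_j\big)$. Missing-data distribution $\mathcal{D}_{\mathsf{miss}}$: draw $Z\sim\mathcal{D}$ and independent $C_1,\dots,C_n\in\{0,1\}$ with $\Pr[C_i=1]=1-p_i$; output $X$ with $X_i=C_iZ_i$. Estimator: for $w\in\mathbb{R}^{2n-1}$, $X\in\{-1,0,1\}^n$, $v_j=w_j-w_{n-1+j}$, and $i\in[n-1]$, $$g^i_{\mathsf{miss}}(w;X)=-\frac{X_n}{1-p_n}\cdot\frac{\exp(-v_iX_nX_i)X_i}{1-p_i}\cdot\prod_{j\in[n-1],\,j\ne i}\frac{\exp(-v_jX_nX_j)-p_j}{1-p_j},$$ $G_{\mathsf{miss}}(w;X)=\sum_{i=1}^{n-1}g^i_{\mathsf{miss}}(w;X)(e^i-e^{n-1+i})\in\mathbb{R}^{2n-1}$ ($e^i$ standard basis vectors). Missing-data SMG algorithm (for vertex $n$): set $w^1_i=\lambda/(2n-1)$ for $i\in[2n-1]$; for $t=1,\dots,T$, draw a fresh independent sample $X^t\sim\mathcal{D}_{\mathsf{miss}}$, let $G^t=G_{\mathsf{miss}}(w^t;X^t)$, $C^t=(w^t)^TG^t/\lambda$, and set $w^{t+1}_i=w^t_i(1-\eta G^t_i+\eta C^t)$ for all $i$; output $\bar w=\frac1T\sum_{t=1}^Tw^t$. *)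

(* Defs.v *)
From Stdlib Require Import Reals Lra List Arith.
Import ListNotations.
Open Scope R_scope.

(* Conventions: indices are 0-based.  Paper index i in [n] is Rocq index i-1.
   Vectors/matrices are functions nat -> R (only indices < dimension matter). *)

Fixpoint rsum (m : nat) (f : nat -> R) : R :=
  match m with O => 0 | S k => rsum k f + f k end.

Fixpoint rprod (m : nat) (f : nat -> R) : R :=
  match m with O => 1 | S k => rprod k f * f k end.

Fixpoint rmax (m : nat) (f : nat -> R) : R :=
  match m with O => f O | S k => Rmax (rmax k f) (f (S k)) end.

Fixpoint rall (m : nat) (b : nat -> bool) : bool :=
  match m with O => true | S k => rall k b && b k end.

Definition lsum {X : Type} (g : X -> R) (l : list X) : R :=
  fold_right (fun a s => g a + s) 0 l.

(* All functions on {0,...,m-1} with values in [vals] (value [d] elsewhere). *)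
Fixpoint fenum {X : Type} (vals : list X) (d : X) (m : nat) : list (nat -> X) :=
  match m with
  | O => [fun _ => d]
  | S k => flat_map (fun f => map (fun c => fun i => if Nat.eqb i k then c else f i) vals)
                    (fenum vals d k)
  end.

Definition spins (n : nat) := fenum [-1; 1] 0 n.
Definition bits (n : nat) := fenum [0; 1] 0 n.
Definition cube (n : nat) := fenum [-1; 0; 1] 0 n.

Definition Reqb (x y : R) : bool := if Req_EM_T x y then true else false.

Definition ising_weight (n : nat) (A : nat -> nat -> R) (z : nat -> R) : R :=
  exp (rsum n (fun j => rsum j (fun i => A i j * z i * z j))).
Definition ising_pr (n : nat) (A : nat -> nat -> R) (z : nat -> R) : R :=
  ising_weight n A z / lsum (ising_weight n A) (spins n).

Definition mask_pr (n : nat) (p : nat -> R) (c : nat -> R) : R :=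
  rprod n (fun i => if Reqb (c i) 1 then 1 - p i else p i).

Definition miss_pr (n : nat) (A : nat -> nat -> R) (p : nat -> R) (x : nat -> R) : R :=
  lsum (fun z => lsum (fun c =>
          if rall n (fun i => Reqb (c i * z i) (x i))
          then ising_pr n A z * mask_pr n p c else 0) (bits n)) (spins n).

Definition vv (n : nat) (w : nat -> R) (j : nat) : R := w j - w (n - 1 + j)%nat.

Definition g_miss (n : nat) (p : nat -> R) (w : nat -> R) (X : nat -> R) (i : nat) : R :=
  - (X (n - 1)%nat / (1 - p (n - 1)%nat))
  * (exp (- vv n w i * X (n - 1)%nat * X i) * X i / (1 - p i))
  * rprod (n - 1) (fun j => if Nat.eqb j i then 1
                            else (exp (- vv n w j * X (n - 1)%nat * X j) - p j) / (1 - p j)).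

(* G_miss(w;X) = sum_i g^i (e^i - e^{n-1+i}) in R^{2n-1} (0-based coordinates 0..2n-2). *)
Definition G_miss (n : nat) (p : nat -> R) (w : nat -> R) (X : nat -> R) (k : nat) : R :=
  if Nat.ltb k (n - 1) then g_miss n p w X k
  else if Nat.ltb k (2 * n - 2) then - g_miss n p w X (k - (n - 1))
  else 0.

Definition smg_step (n : nat) (p : nat -> R) (lam eta : R) (w : nat -> R) (X : nat -> R)
  : nat -> R :=
  let G := G_miss n p w X in
  let C := rsum (2 * n - 1) (fun k => w k * G k) / lam in
  fun k => w k * (1 - eta * G k + eta * C).

(* smg_iterate ... Xs t = w^{t+1}, where Xs t = X^{t+1} (0-based time). *)
Fixpoint smg_iterate (n : nat) (p : nat -> R) (lam eta : R) (Xs : nat -> nat -> R)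
  (t : nat) : nat -> R :=
  match t with
  | O => fun _ => lam / INR (2 * n - 1)
  | S s => smg_step n p lam eta (smg_iterate n p lam eta Xs s) (Xs s)
  end.

Definition smg_output (n : nat) (p : nat -> R) (lam eta : R) (T : nat)
  (Xs : nat -> nat -> R) : nat -> R :=
  fun k => / INR T * rsum T (fun t => smg_iterate n p lam eta Xs t k).

Definition smg_success (n : nat) (A : nat -> nat -> R) (eps : R) (wbar : nat -> R) : bool :=
  rall (n - 1) (fun i =>
    if Rle_dec (Rabs (wbar i - wbar (n - 1 + i)%nat - A (n - 1)%nat i)) eps
    then true else false).

Definition smg_success_prob (n : nat) (A : nat -> nat -> R) (p : nat -> R)
  (lam eta eps : R) (T : nat) : R :=
  lsum (fun Xs => if smg_success n A eps (smg_output n p lam eta T Xs)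
                  then rprod T (fun t => miss_pr n A p (Xs t)) else 0)
       (fenum (cube n) (fun _ => 0) T).

(* Main.v *)
Require Import Defs.
From Stdlib Require Import Reals.
From Stdlib Require Import Lra Lia List Arith.
Import ListNotations.
Open Scope R_scope.

(** With [u] the nonnegative lift of the row [A_n] to the simplex of mass [lam], the
    mean of [<w - u, G_miss (w; X)>] is, after summing out [Z_n], the mean of
    [D sinh D / cosh S] with [D = <v - A_n, Z>] and [S = <A_n, Z>].  Since
    [x sinh x >= x^2 / 2], [cosh S <= exp lam], and resampling [Z_i] alone gives [D]
    conditional variance at least [exp (-2 lam) (v_i - A_ni)^2], it is at least
    [exp (-3 lam) / 2 * (v_i - A_ni)^2].  Summed over time, it is controlled by the
    regret of multiplicative weights and by the Azuma bound for the martingale of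
    the gradient noise. *)

(** No union bound over coordinates is needed: an error above [eps] at any [i], even one chosen by
    the sample, forces up the same martingale, because the curvature bound holds for every [i] at
    once.

    The danger in missing data is the product of debiasing factors, each with a denominator
    [1 - p_j], which could grow exponentially in [n]. Convexity of exp moves [1 / (1 - p_j)] into
    the exponent beside [|v_j|]. Multiplicative weights keep the l1 norm of [v] at most [lam], so
    the gradient is bounded by B = (1 - pmax)^(-2) exp (lam / (1 - pmax)), free of [n].

    The step size is sqrt (log (2n-1) / T) / (2 B). Regret and noise are then both of order lam B
    sqrt (T log (n/delta)), against a signal exp (-3 lam) T eps^2 / 2. Absorbing [lam] by 2 lam <=
    exp (2 lam), it suffices that sqrt T >= 30 B exp (5 lam) sqrt (log (n/delta)) / eps^2; squaring
    gives the exponent 2 / (1 - pmax) + 10 and K = 900. *)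

(** * Finite sums, products and maxima *)

Lemma lsum_ext_in {X : Type} (f g : X -> R) (l : list X) :
  (forall x, In x l -> f x = g x) -> lsum f l = lsum g l.
Proof.
  induction l as [|a l IH]; intros H; simpl; [easy|].
  rewrite H by now left. f_equal. apply IH. intros; apply H; now right.
Qed.

Lemma lsum_le_in {X : Type} (f g : X -> R) (l : list X) :
  (forall x, In x l -> f x <= g x) -> lsum f l <= lsum g l.
Proof.
  induction l as [|a l IH]; intros H; simpl; [lra|].
  apply Rplus_le_compat; [apply H; now left | apply IH; intros; apply H; now right].
Qed.

Lemma lsum_const0 {X : Type} (l : list X) : lsum (fun _ => 0) l = 0.
Proof. induction l; simpl; lra. Qed.

Lemma lsum_nonneg_in {X : Type} (f : X -> R) (l : list X) :
  (forall x, In x l -> 0 <= f x) -> 0 <= lsum f l.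
Proof. intros H. rewrite <- (lsum_const0 l). now apply lsum_le_in. Qed.

Lemma lsum_plus {X : Type} (f g : X -> R) (l : list X) :
  lsum (fun x => f x + g x) l = lsum f l + lsum g l.
Proof. induction l; simpl; lra. Qed.

Lemma lsum_scal {X : Type} (c : R) (f : X -> R) (l : list X) :
  lsum (fun x => c * f x) l = c * lsum f l.
Proof. induction l as [|a l IH]; simpl; [ring|rewrite IH; ring]. Qed.

Lemma lsum_app {X : Type} (f : X -> R) (l l' : list X) :
  lsum f (l ++ l') = lsum f l + lsum f l'.
Proof. induction l; simpl; lra. Qed.

Lemma lsum_map {X Y : Type} (f : Y -> R) (h : X -> Y) (l : list X) :
  lsum f (map h l) = lsum (fun x => f (h x)) l.
Proof. induction l as [|a l IH]; simpl; [easy|now rewrite IH]. Qed.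

Lemma lsum_flat_map {X Y : Type} (f : Y -> R) (h : X -> list Y) (l : list X) :
  lsum f (flat_map h l) = lsum (fun x => lsum f (h x)) l.
Proof. induction l as [|a l IH]; simpl; [easy|now rewrite lsum_app, IH]. Qed.

Lemma lsum_swap {X Y : Type} (f : X -> Y -> R) (l : list X) (l' : list Y) :
  lsum (fun x => lsum (f x) l') l = lsum (fun y => lsum (fun x => f x y) l) l'.
Proof.
  induction l as [|a l IH]; simpl.
  - now rewrite lsum_const0.
  - now rewrite IH, <- lsum_plus.
Qed.

Lemma rsum_ext (m : nat) (f g : nat -> R) :
  (forall i, (i < m)%nat -> f i = g i) -> rsum m f = rsum m g.
Proof.
  induction m as [|m IH]; intros H; simpl; [easy|].
  rewrite H by lia. rewrite IH; [easy|intros; apply H; lia].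
Qed.

Lemma rsum_le (m : nat) (f g : nat -> R) :
  (forall i, (i < m)%nat -> f i <= g i) -> rsum m f <= rsum m g.
Proof.
  induction m as [|m IH]; intros H; simpl; [lra|].
  apply Rplus_le_compat; [apply IH; intros|]; apply H; lia.
Qed.

Lemma rsum_plus (m : nat) (f g : nat -> R) :
  rsum m (fun i => f i + g i) = rsum m f + rsum m g.
Proof. induction m; simpl; lra. Qed.

Lemma rsum_minus (m : nat) (f g : nat -> R) :
  rsum m (fun i => f i - g i) = rsum m f - rsum m g.
Proof. induction m; simpl; lra. Qed.

Lemma rsum_scal (m : nat) (c : R) (f : nat -> R) :
  rsum m (fun i => c * f i) = c * rsum m f.
Proof. induction m as [|m IH]; simpl; [ring|rewrite IH; ring]. Qed.

Lemma rsum_const (m : nat) (c : R) : rsum m (fun _ => c) = INR m * c.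
Proof. induction m as [|m IH]; [simpl; ring|]. rewrite S_INR. simpl. rewrite IH. ring. Qed.

Lemma rsum_nonneg (m : nat) (f : nat -> R) :
  (forall i, (i < m)%nat -> 0 <= f i) -> 0 <= rsum m f.
Proof.
  intros H. replace 0 with (rsum m (fun _ => 0)) by (rewrite rsum_const; ring).
  now apply rsum_le.
Qed.

Lemma rsum_ge_term (m : nat) (f : nat -> R) (k : nat) :
  (forall i, (i < m)%nat -> 0 <= f i) -> (k < m)%nat -> f k <= rsum m f.
Proof.
  induction m as [|m IH]; intros H Hk; simpl; [lia|].
  destruct (Nat.eq_dec k m) as [->|].
  - assert (0 <= rsum m f) by (apply rsum_nonneg; intros; apply H; lia). lra.
  - assert (f k <= rsum m f) by (apply IH; [intros; apply H|]; lia).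
    assert (0 <= f m) by (apply H; lia). lra.
Qed.

Lemma rsum_abs (m : nat) (f : nat -> R) :
  Rabs (rsum m f) <= rsum m (fun i => Rabs (f i)).
Proof.
  induction m as [|m IH]; simpl; [rewrite Rabs_R0; lra|].
  eapply Rle_trans; [apply Rabs_triang|lra].
Qed.

Lemma rsum_add (a b : nat) (f : nat -> R) :
  rsum (a + b) f = rsum a f + rsum b (fun i => f (a + i)%nat).
Proof.
  induction b as [|b IH]; simpl.
  - rewrite Nat.add_0_r; ring.
  - rewrite Nat.add_succ_r; simpl. rewrite IH; ring.
Qed.

Lemma rsum_lsum {X : Type} (m : nat) (f : nat -> X -> R) (l : list X) :
  rsum m (fun i => lsum (f i) l) = lsum (fun x => rsum m (fun i => f i x)) l.
Proof.
  induction m as [|m IH]; simpl.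
  - now rewrite lsum_const0.
  - now rewrite IH, <- lsum_plus.
Qed.

(** Cauchy-Schwarz against the constant 1. It passes from the error of the averaged output to the
    squared errors of the iterates. *)
Lemma rsum_square_le (m : nat) (f : nat -> R) :
  rsum m f * rsum m f <= INR m * rsum m (fun i => f i * f i).
Proof.
  induction m as [|m IH]; [simpl; lra|].
  rewrite S_INR. simpl.
  set (s := rsum m f) in *. set (q := rsum m (fun i => f i * f i)) in *.
  assert (Hq : 2 * f m * s <= INR m * (f m * f m) + q).
  { unfold s, q. rewrite <- rsum_const, <- rsum_plus, <- rsum_scal.
    apply rsum_le. intros i _. cbv beta. assert (H := Rle_0_sqr (f m - f i)). unfold Rsqr in H. lra. }
  nra.
Qed.

Lemma rprod_ext (m : nat) (f g : nat -> R) :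
  (forall i, (i < m)%nat -> f i = g i) -> rprod m f = rprod m g.
Proof.
  induction m as [|m IH]; intros H; simpl; [easy|].
  rewrite H by lia. rewrite IH; [easy|intros; apply H; lia].
Qed.

Lemma rprod_nonneg (m : nat) (f : nat -> R) :
  (forall i, (i < m)%nat -> 0 <= f i) -> 0 <= rprod m f.
Proof.
  induction m as [|m IH]; intros H; simpl; [lra|].
  apply Rmult_le_pos; [apply IH; intros|]; apply H; lia.
Qed.

Lemma rprod_const1 (m : nat) : rprod m (fun _ => 1) = 1.
Proof. induction m as [|m IH]; simpl; [easy|rewrite IH; ring]. Qed.

Lemma rprod_mult (m : nat) (f g : nat -> R) :
  rprod m (fun i => f i * g i) = rprod m f * rprod m g.
Proof. induction m as [|m IH]; simpl; [ring|rewrite IH; ring]. Qed.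

Lemma rprod_exp (m : nat) (f : nat -> R) :
  rprod m (fun i => exp (f i)) = exp (rsum m f).
Proof. induction m as [|m IH]; simpl; [now rewrite exp_0|now rewrite IH, exp_plus]. Qed.

(** The estimator writes a product over [j] different from [i] by placing 1 in slot [i]. Moving the
    special factor into that slot gives one full product, to which factorwise lemmas apply. *)
Lemma rprod_extract (m : nat) (f : nat -> R) (a : R) (i : nat) :
  (i < m)%nat ->
  a * rprod m (fun j => if Nat.eqb j i then 1 else f j)
  = rprod m (fun j => if Nat.eqb j i then a else f j).
Proof.
  induction m as [|m IH]; intros Hi; simpl; [lia|].
  destruct (Nat.eq_dec m i) as [->|Hne].
  - rewrite Nat.eqb_refl.
    rewrite (rprod_ext i (fun j => if Nat.eqb j i then 1 else f j) f).
    + rewrite (rprod_ext i (fun j => if Nat.eqb j i then a else f j) f); [ring|].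
      intros j Hj. destruct (Nat.eqb_spec j i); [lia|easy].
    + intros j Hj. destruct (Nat.eqb_spec j i); [lia|easy].
  - destruct (Nat.eqb_spec m i); [lia|]. rewrite <- IH by lia. ring.
Qed.

Lemma rprod_abs_le_exp (m : nat) (f g : nat -> R) :
  (forall i, (i < m)%nat -> Rabs (f i) <= exp (g i)) ->
  Rabs (rprod m f) <= exp (rsum m g).
Proof.
  induction m as [|m IH]; intros H; simpl.
  - rewrite Rabs_R1, exp_0; lra.
  - rewrite Rabs_mult, exp_plus. apply Rmult_le_compat; try apply Rabs_pos.
    + apply IH; intros; apply H; lia.
    + apply H; lia.
Qed.

Lemma rmax_ge (m : nat) (f : nat -> R) (i : nat) : (i <= m)%nat -> f i <= rmax m f.
Proof.
  induction m as [|m IH]; intros Hi; simpl.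
  - replace i with 0%nat by lia; lra.
  - destruct (Nat.eq_dec i (S m)) as [->|]; [apply Rmax_r|].
    eapply Rle_trans; [apply IH; lia|apply Rmax_l].
Qed.

Lemma rmax_lt (m : nat) (f : nat -> R) (c : R) :
  (forall i, (i <= m)%nat -> f i < c) -> rmax m f < c.
Proof.
  induction m as [|m IH]; intros H; simpl; [apply H; lia|].
  apply Rmax_lub_lt; [apply IH; intros|]; apply H; lia.
Qed.

Lemma rall_false (m : nat) (b : nat -> bool) :
  rall m b = false -> exists i, (i < m)%nat /\ b i = false.
Proof.
  induction m as [|m IH]; simpl; [easy|].
  intros H. apply Bool.andb_false_iff in H. destruct H as [H|H].
  - destruct (IH H) as [i [Hi Hb]]. exists i; split; [lia|easy].
  - exists m; split; [lia|easy].
Qed.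

Lemma rall_ext (m : nat) (b b' : nat -> bool) :
  (forall i, (i < m)%nat -> b i = b' i) -> rall m b = rall m b'.
Proof.
  induction m as [|m IH]; intros H; simpl; [easy|].
  rewrite H by lia. rewrite IH; [easy|intros; apply H; lia].
Qed.

(** * Sums over enumerated functions *)

Definition upd {X : Type} (f : nat -> X) (k : nat) (c : X) : nat -> X :=
  fun i => if Nat.eqb i k then c else f i.

Lemma upd_same {X : Type} (f : nat -> X) (k : nat) (c : X) : upd f k c k = c.
Proof. unfold upd. now rewrite Nat.eqb_refl. Qed.

Lemma upd_lt {X : Type} (f : nat -> X) (k : nat) (c : X) (i : nat) :
  (i < k)%nat -> upd f k c i = f i.
Proof. intros H. unfold upd. destruct (Nat.eqb_spec i k); [lia|easy]. Qed.

(** Stands in for functional extensionality: a vector such as [fun i => c i * z i] agrees with an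
    enumerated one only on the first indices. On sample paths it also expresses predictability. *)
Definition depends_below {X Y : Type} (k : nat) (F : (nat -> X) -> Y) : Prop :=
  forall f g, (forall i, (i < k)%nat -> f i = g i) -> F f = F g.

Lemma depends_below_upd {X Y : Type} (k : nat) (F : (nat -> X) -> Y) (c : X) :
  depends_below (S k) F -> depends_below k (fun f => F (upd f k c)).
Proof.
  intros H f g Hfg. apply H. intros i Hi. unfold upd.
  destruct (Nat.eqb_spec i k); [easy|apply Hfg; lia].
Qed.

Lemma upd_self_ext {X Y : Type} (k : nat) (F : (nat -> X) -> Y) (f : nat -> X) :
  depends_below (S k) F -> F (upd f k (f k)) = F f.
Proof.
  intros H. apply H. intros i Hi. unfold upd. destruct (Nat.eqb_spec i k); now subst.
Qed.

(** The distinguished vertex and the latest sample both sit at the last index, so this recursion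
    sums out either of them. *)
Lemma lsum_fenum_S {X : Type} (vals : list X) (d : X) (k : nat) (g : (nat -> X) -> R) :
  lsum g (fenum vals d (S k))
  = lsum (fun f => lsum (fun c => g (upd f k c)) vals) (fenum vals d k).
Proof.
  simpl. rewrite lsum_flat_map. apply lsum_ext_in. intros f _. now rewrite lsum_map.
Qed.

Lemma fenum_in {X : Type} (vals : list X) (d : X) (k : nat) (f : nat -> X) (i : nat) :
  In f (fenum vals d k) -> (i < k)%nat -> In (f i) vals.
Proof.
  revert f. induction k as [|k IH]; intros f Hf Hi; [lia|].
  simpl in Hf. apply in_flat_map in Hf. destruct Hf as [h [Hh Hf]].
  apply in_map_iff in Hf. destruct Hf as [c [<- Hc]].
  destruct (Nat.eqb_spec i k); [easy|]. apply IH; [easy|lia].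
Qed.

Lemma lsum_fenum_rprod {X : Type} (vals : list X) (d : X) (k : nat) (phi : nat -> X -> R) :
  lsum (fun f => rprod k (fun i => phi i (f i))) (fenum vals d k)
  = rprod k (fun i => lsum (phi i) vals).
Proof.
  induction k as [|k IH]; [simpl; ring|].
  rewrite lsum_fenum_S. simpl rprod. rewrite <- IH.
  rewrite Rmult_comm, <- lsum_scal. apply lsum_ext_in. intros f _.
  rewrite Rmult_comm, <- lsum_scal. apply lsum_ext_in. intros c _.
  rewrite upd_same. f_equal. apply rprod_ext. intros i Hi. now rewrite upd_lt.
Qed.

Lemma Reqb_refl (x : R) : Reqb x x = true.
Proof. unfold Reqb. destruct (Req_EM_T x x); [easy|lra]. Qed.

Lemma Reqb_neq (x y : R) : x <> y -> Reqb x y = false.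
Proof. intros H. unfold Reqb. destruct (Req_EM_T x y); [easy|easy]. Qed.

Lemma lsum_cube_pick (k : nat) (y : nat -> R) (F : (nat -> R) -> R) :
  (forall i, (i < k)%nat -> In (y i) [-1; 0; 1]) -> depends_below k F ->
  lsum (fun x => if rall k (fun i => Reqb (y i) (x i)) then F x else 0) (cube k) = F y.
Proof.
  unfold cube. revert F. induction k as [|k IH]; intros F Hy HF.
  - simpl. rewrite Rplus_0_r. apply HF; intros; lia.
  - rewrite lsum_fenum_S. rewrite <- (upd_self_ext k F y HF).
    rewrite <- (IH (fun f => F (upd f k (y k))));
      [|intros; apply Hy; lia|now apply depends_below_upd].
    apply lsum_ext_in. intros f _.
    (* The test splits into one on the first [k] coordinates and one on the last, which exactly one
       of the three values passes. *)
    assert (Hr : forall c, rall (S k) (fun i => Reqb (y i) (upd f k c i))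
              = (rall k (fun i => Reqb (y i) (f i)) && Reqb (y k) c)%bool).
    { intros c. simpl. rewrite upd_same. f_equal. apply rall_ext.
      intros i Hi. now rewrite upd_lt. }
    cbn [lsum fold_right]. rewrite !Hr.
    destruct (rall k (fun i => Reqb (y i) (f i))); simpl; [|ring].
    assert (Hk := Hy k ltac:(lia)).
    destruct Hk as [E|[E|[E|[]]]]; rewrite <- E, Reqb_refl, !Reqb_neq by lra; ring.
Qed.

(** * Expectation under missing data *)

Definition miss_mean (n : nat) (A : nat -> nat -> R) (p : nat -> R) (F : (nat -> R) -> R) : R :=
  lsum (fun x => miss_pr n A p x * F x) (cube n).

(** After exchanging the sums, each pair of spins and mask leaves a sum over [x] that singles out
    their product: the law of [X] is a push-forward. *)
Lemma miss_mean_expand (n : nat) (A : nat -> nat -> R) (p : nat -> R) (F : (nat -> R) -> R) :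
  depends_below n F ->
  miss_mean n A p F
  = lsum (fun z => ising_pr n A z
                   * lsum (fun c => mask_pr n p c * F (fun i => c i * z i)) (bits n)) (spins n).
Proof.
  intros HF. unfold miss_mean, miss_pr.
  transitivity (lsum (fun x => lsum (fun z => lsum (fun c =>
     ising_pr n A z * mask_pr n p c *
     (if rall n (fun i => Reqb (c i * z i) (x i)) then F x else 0)) (bits n)) (spins n)) (cube n)).
  - apply lsum_ext_in. intros x _. rewrite Rmult_comm, <- lsum_scal.
    apply lsum_ext_in. intros z _. rewrite <- lsum_scal.
    apply lsum_ext_in. intros c _.
    destruct (rall n (fun i => Reqb (c i * z i) (x i))); ring.
  - rewrite lsum_swap. apply lsum_ext_in. intros z Hz. rewrite lsum_swap, <- lsum_scal.
    apply lsum_ext_in. intros c Hc. rewrite lsum_scal, Rmult_assoc. do 2 f_equal.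
    apply (lsum_cube_pick n (fun i => c i * z i)); [|easy].
    intros i Hi. assert (Hzi := fenum_in _ _ _ _ i Hz Hi).
    assert (Hci := fenum_in _ _ _ _ i Hc Hi).
    destruct Hzi as [<-|[<-|[]]]; destruct Hci as [<-|[<-|[]]]; simpl;
      [right; left|left|right; left|right; right; left]; ring.
Qed.

(** Independence of the mask bits. It allows the debiasing to be checked one factor at a time. *)
Lemma mask_rprod_mean (k : nat) (p : nat -> R) (phi : nat -> R -> R) :
  lsum (fun c => mask_pr k p c * rprod k (fun j => phi j (c j))) (bits k)
  = rprod k (fun j => p j * phi j 0 + (1 - p j) * phi j 1).
Proof.
  unfold mask_pr, bits.
  transitivity (lsum (fun c => rprod k (fun j =>
     (fun j cj => (if Reqb cj 1 then 1 - p j else p j) * phi j cj) j (c j))) (fenum [0; 1] 0 k)).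
  - apply lsum_ext_in. intros c _. now rewrite <- rprod_mult.
  - rewrite (lsum_fenum_rprod [0; 1] 0 k
      (fun j cj => (if Reqb cj 1 then 1 - p j else p j) * phi j cj)).
    apply rprod_ext. intros j _. simpl. rewrite Reqb_refl, Reqb_neq by lra. ring.
Qed.

Lemma mask_pr_total (k : nat) (p : nat -> R) : lsum (mask_pr k p) (bits k) = 1.
Proof.
  transitivity (lsum (fun c => mask_pr k p c * rprod k (fun j => (fun _ _ => 1) j (c j))) (bits k)).
  - apply lsum_ext_in. intros c _. rewrite rprod_const1; ring.
  - rewrite (mask_rprod_mean k p (fun _ _ => 1)).
    transitivity (rprod k (fun _ => 1)); [apply rprod_ext; intros; ring|apply rprod_const1].
Qed.

Lemma lsum_fenum_pos {X : Type} (vals : list X) (d : X) (k : nat) (F : (nat -> X) -> R) :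
  vals <> [] -> (forall f, 0 < F f) -> 0 < lsum F (fenum vals d k).
Proof.
  intros Hv. revert F. induction k as [|k IH]; intros F HF.
  - simpl. specialize (HF (fun _ => d)). lra.
  - rewrite lsum_fenum_S. apply IH. intros f.
    destruct vals as [|v vals]; [easy|]. simpl.
    apply Rplus_lt_le_0_compat; [apply HF|].
    apply lsum_nonneg_in. intros; left; apply HF.
Qed.

Lemma ising_weight_pos (n : nat) (A : nat -> nat -> R) (z : nat -> R) : 0 < ising_weight n A z.
Proof. apply exp_pos. Qed.

Lemma ising_partition_pos (n : nat) (A : nat -> nat -> R) : 0 < lsum (ising_weight n A) (spins n).
Proof. apply lsum_fenum_pos; [easy|]. intros; apply ising_weight_pos. Qed.

Lemma ising_pr_total (n : nat) (A : nat -> nat -> R) : lsum (ising_pr n A) (spins n) = 1.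
Proof.
  assert (H := ising_partition_pos n A). unfold ising_pr.
  transitivity (/ lsum (ising_weight n A) (spins n) * lsum (ising_weight n A) (spins n)).
  - rewrite <- lsum_scal. apply lsum_ext_in. intros z _. field. lra.
  - field. lra.
Qed.

Lemma miss_pr_total (n : nat) (A : nat -> nat -> R) (p : nat -> R) :
  lsum (miss_pr n A p) (cube n) = 1.
Proof.
  transitivity (miss_mean n A p (fun _ => 1)).
  - apply lsum_ext_in. intros; ring.
  - rewrite miss_mean_expand by easy.
    transitivity (lsum (ising_pr n A) (spins n)); [|apply ising_pr_total].
    apply lsum_ext_in. intros z _.
    rewrite (lsum_ext_in _ (mask_pr n p)) by (intros; ring).
    rewrite mask_pr_total; ring.
Qed.

Lemma miss_pr_nonneg (n : nat) (A : nat -> nat -> R) (p x : nat -> R) :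
  (forall i, (i < n)%nat -> 0 <= p i < 1) -> 0 <= miss_pr n A p x.
Proof.
  intros Hp. apply lsum_nonneg_in. intros z _. apply lsum_nonneg_in. intros c _.
  destruct (rall n _); [|lra]. apply Rmult_le_pos.
  - unfold ising_pr. left. apply Rdiv_lt_0_compat; [apply ising_weight_pos|apply ising_partition_pos].
  - apply rprod_nonneg. intros i Hi. specialize (Hp i Hi). destruct (Reqb _ _); lra.
Qed.

Lemma Rabs_le_between (x a : R) : Rabs x <= a -> - a <= x <= a.
Proof.
  intros H. assert (H1 := Rle_abs x). assert (H2 := Rle_abs (- x)).
  rewrite Rabs_Ropp in H2. lra.
Qed.

Lemma exp_le_compat (x y : R) : x <= y -> exp x <= exp y.
Proof. intros [H| ->]; [left; now apply exp_increasing|lra]. Qed.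

(** * Curvature of the mean gradient *)

Lemma rsum_single (k : nat) (h : nat -> R) (i : nat) :
  (i < k)%nat -> (forall j, (j < k)%nat -> j <> i -> h j = 0) -> rsum k h = h i.
Proof.
  induction k as [|k IH]; intros Hi H; simpl; [lia|].
  destruct (Nat.eq_dec k i) as [->|Hne].
  - rewrite (rsum_ext i h (fun _ => 0)) by (intros; apply H; lia).
    rewrite rsum_const; ring.
  - rewrite (H k) by lia. rewrite IH; [ring|lia|intros; apply H; lia].
Qed.

Lemma spins_sqr (k : nat) (z : nat -> R) (i : nat) :
  In z (spins k) -> (i < k)%nat -> z i * z i = 1.
Proof.
  intros Hz Hi. destruct (fenum_in _ _ _ _ i Hz Hi) as [<-|[<-|[]]]; ring.
Qed.

Lemma spins_abs (k : nat) (z : nat -> R) (i : nat) :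
  In z (spins k) -> (i < k)%nat -> Rabs (z i) = 1.
Proof.
  intros Hz Hi. destruct (fenum_in _ _ _ _ i Hz Hi) as [<-|[<-|[]]].
  - rewrite Rabs_left; lra.
  - apply Rabs_R1.
Qed.

Definition lin (m : nat) (a z : nat -> R) : R := rsum m (fun k => a k * z k).

Lemma lin_depends (m : nat) (a : nat -> R) : depends_below m (lin m a).
Proof. intros f g H. apply rsum_ext. intros i Hi. now rewrite H. Qed.

Lemma lin_upd (m : nat) (a f : nat -> R) (c : R) : lin m a (upd f m c) = lin m a f.
Proof. apply lin_depends. intros; now apply upd_lt. Qed.

Lemma lin_sub (m : nat) (a b z : nat -> R) :
  lin m (fun k => a k - b k) z = lin m a z - lin m b z.
Proof. unfold lin. rewrite <- rsum_minus. apply rsum_ext; intros; ring. Qed.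

Lemma lin_abs_le (m : nat) (a z : nat -> R) :
  (forall k, (k < m)%nat -> Rabs (z k) <= 1) ->
  Rabs (lin m a z) <= rsum m (fun k => Rabs (a k)).
Proof.
  intros H. unfold lin. eapply Rle_trans; [apply rsum_abs|]. apply rsum_le.
  intros k Hk. rewrite Rabs_mult. specialize (H k Hk).
  assert (0 <= Rabs (a k)) by apply Rabs_pos. nra.
Qed.

Lemma lin_flip (m : nat) (a z : nat -> R) (i : nat) :
  (i < m)%nat -> lin m a z - lin m a (upd z i (- z i)) = 2 * a i * z i.
Proof.
  intros Hi. unfold lin. rewrite <- rsum_minus.
  rewrite (rsum_single m _ i Hi).
  - rewrite upd_same. ring.
  - intros j _ Hj. unfold upd. destruct (Nat.eqb_spec j i); [easy|ring].
Qed.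

(** * Ising weights: splitting off the last spin, flipping one spin *)

Definition energy (n : nat) (A : nat -> nat -> R) (z : nat -> R) : R :=
  rsum n (fun j => rsum j (fun i => A i j * z i * z j)).

Lemma energy_depends (n : nat) (A : nat -> nat -> R) : depends_below n (energy n A).
Proof.
  intros f g H. apply rsum_ext. intros j Hj. apply rsum_ext. intros i Hi.
  rewrite !H by lia. easy.
Qed.

Lemma ising_weight_depends (n : nat) (A : nat -> nat -> R) : depends_below n (ising_weight n A).
Proof. intros f g H. unfold ising_weight. f_equal. now apply energy_depends. Qed.

(** The last spin interacts with the others through its local field; symmetry turns the column
    [A i m] of the definition into the row [A m]. *)
Lemma ising_weight_S (m : nat) (A : nat -> nat -> R) (f : nat -> R) (c : R) :
  (forall i j, (i < S m)%nat -> (j < S m)%nat -> A i j = A j i) ->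
  ising_weight (S m) A (upd f m c) = ising_weight m A f * exp (c * lin m (A m) f).
Proof.
  intros Hs. unfold ising_weight. rewrite <- exp_plus. f_equal. simpl. f_equal.
  - apply (energy_depends m A). intros; now apply upd_lt.
  - unfold lin. rewrite <- rsum_scal. apply rsum_ext. intros i Hi.
    rewrite upd_same, upd_lt by easy. rewrite (Hs i m) by lia. ring.
Qed.

(** Only pairs containing [i] change, each by twice its coefficient at most. Pairs are grouped by
    their larger index, hence the induction on truncated energies, which starts at the first row
    containing [z i]. *)
Lemma energy_flip (n : nat) (A : nat -> nat -> R) (z : nat -> R) (i : nat) :
  (forall i j, (i < n)%nat -> (j < n)%nat -> A i j = A j i) ->
  (forall k, (k < n)%nat -> Rabs (z k) <= 1) -> (i < n)%nat ->
  Rabs (energy n A (upd z i (- z i)) - energy n A z) <= 2 * rsum n (fun j => Rabs (A i j)).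
Proof.
  intros Hs Hz Hi.
  assert (Hbelow : forall k, (k <= i)%nat -> energy k A (upd z i (- z i)) = energy k A z).
  { intros k Hk. apply energy_depends. intros j Hj. apply upd_lt. lia. }
  assert (H : forall k, (k <= n)%nat -> (i < k)%nat ->
    Rabs (energy k A (upd z i (- z i)) - energy k A z) <= 2 * rsum k (fun j => Rabs (A i j)));
    [|now apply H].
  intros k. induction k as [|k IH]; intros Hkn Hik; [lia|].
  unfold energy. simpl. fold (energy k A (upd z i (- z i))). fold (energy k A z).
  set (s1 := rsum k (fun l => A l k * upd z i (- z i) l * upd z i (- z i) k)).
  set (s2 := rsum k (fun l => A l k * z l * z k)).
  destruct (Nat.eq_dec k i) as [->|Hne].
  (* Row [i] consists of all pairs [(l, i)] with [l < i]; every one of them changes sign. *)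
  - rewrite Hbelow by lia.
    replace (energy i A z + s1 - (energy i A z + s2)) with (s1 - s2) by ring.
    assert (Rabs (s1 - s2) <= 2 * rsum i (fun j => Rabs (A i j))).
    { unfold s1, s2. rewrite <- rsum_minus, <- rsum_scal.
      eapply Rle_trans; [apply rsum_abs|]. apply rsum_le. intros l Hl.
      rewrite upd_same, upd_lt, (Hs l i) by lia.
      replace (A i l * z l * - z i - A i l * z l * z i) with (A i l * (-2 * (z l * z i))) by ring.
      rewrite Rabs_mult. rewrite Rabs_mult, Rabs_mult.
      replace (Rabs (-2)) with 2 by (rewrite Rabs_left; lra).
      assert (Hl1 := Hz l ltac:(lia)). assert (Hi1 := Hz i Hi).
      assert (0 <= Rabs (A i l)) by apply Rabs_pos.
      assert (0 <= Rabs (z l)) by apply Rabs_pos. assert (0 <= Rabs (z i)) by apply Rabs_pos.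
      assert (Rabs (z l) * Rabs (z i) <= 1) by nra. nra. }
    assert (0 <= Rabs (A i i)) by apply Rabs_pos. lra.
  (* A row after [i] meets [z i] in the single pair [(i, k)]. *)
  - assert (IHk := IH ltac:(lia) ltac:(lia)).
    replace (energy k A (upd z i (- z i)) + s1 - (energy k A z + s2))
      with ((energy k A (upd z i (- z i)) - energy k A z) + (s1 - s2)) by ring.
    eapply Rle_trans; [apply Rabs_triang|].
    assert (Rabs (s1 - s2) <= 2 * Rabs (A i k)); [|lra].
    unfold s1, s2. rewrite <- rsum_minus.
    rewrite (rsum_single k _ i ltac:(lia)).
    + rewrite upd_same. unfold upd. destruct (Nat.eqb_spec k i); [easy|].
      replace (A i k * - z i * z k - A i k * z i * z k) with (A i k * (-2 * (z i * z k))) by ring.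
      rewrite Rabs_mult, Rabs_mult, Rabs_mult.
      replace (Rabs (-2)) with 2 by (rewrite Rabs_left; lra).
      assert (Hl1 := Hz k ltac:(lia)). assert (Hi1 := Hz i Hi).
      assert (0 <= Rabs (A i k)) by apply Rabs_pos.
      assert (0 <= Rabs (z k)) by apply Rabs_pos. assert (0 <= Rabs (z i)) by apply Rabs_pos.
      assert (Rabs (z i) * Rabs (z k) <= 1) by nra. nra.
    + intros j Hj Hji. unfold upd.
      destruct (Nat.eqb_spec j i); [easy|]. destruct (Nat.eqb_spec k i); [easy|ring].
Qed.

(** The flip is a bijection of the cube: at the last coordinate it swaps the two terms, elsewhere it
    commutes with setting the last coordinate. *)
Lemma lsum_spins_flip (n : nat) (F : (nat -> R) -> R) (i : nat) :
  (i < n)%nat -> depends_below n F ->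
  lsum (fun z => F (upd z i (- z i))) (spins n) = lsum F (spins n).
Proof.
  unfold spins. revert F. induction n as [|n IH]; intros F Hi HF; [lia|].
  rewrite !lsum_fenum_S.
  destruct (Nat.eq_dec i n) as [->|Hne].
  - apply lsum_ext_in. intros f _. simpl. rewrite !upd_same.
    assert (E : forall c, F (upd (upd f n c) n (- c)) = F (upd f n (- c))).
    { intros c. apply HF. intros j _. unfold upd. destruct (Nat.eqb_spec j n); easy. }
    rewrite !E. replace (- -1) with 1 by ring. replace (- (1)) with (-1) by ring. ring.
  - rewrite <- (IH (fun f => lsum (fun c => F (upd f n c)) [-1; 1])).
    + apply lsum_ext_in. intros f _. apply lsum_ext_in. intros c _. apply HF.
      intros j _. unfold upd.
      destruct (Nat.eqb_spec i n); [lia|].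
      destruct (Nat.eqb_spec j i), (Nat.eqb_spec j n); easy || lia.
    + lia.
    + intros f g Hfg. apply lsum_ext_in. intros c _. now apply depends_below_upd.
Qed.

(* Resampling coordinate [i] given the others has conditional variance at least
   [exp (-2 lam)]; it is isolated by averaging over the flip of [z i]. *)
Lemma ising_second_moment (m : nat) (A : nat -> nat -> R) (lam : R) (a : nat -> R) (i : nat) :
  (forall i j, (i < m)%nat -> (j < m)%nat -> A i j = A j i) ->
  (i < m)%nat -> rsum m (fun j => Rabs (A i j)) <= lam ->
  exp (-2 * lam) * (a i * a i) * lsum (ising_weight m A) (spins m)
  <= lsum (fun z => ising_weight m A z * (lin m a z * lin m a z)) (spins m).
Proof.
  intros Hs Hi Hlam.
  set (F := fun z => ising_weight m A z * (lin m a z * lin m a z)).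
  assert (HF : depends_below m F).
  { intros f g Hfg. unfold F.
    rewrite (ising_weight_depends m A f g Hfg), (lin_depends m a f g Hfg). easy. }
  assert (H1 := lsum_spins_flip m F i Hi HF).
  assert (H2 := lsum_spins_flip m _ i Hi (ising_weight_depends m A)).
  assert (H : exp (-2 * lam) * (a i * a i) *
     lsum (fun z => ising_weight m A z + ising_weight m A (upd z i (- z i))) (spins m)
     <= lsum (fun z => F z + F (upd z i (- z i))) (spins m)).
  { rewrite <- lsum_scal. apply lsum_le_in. intros z Hz. unfold F.
    assert (Hfl := lin_flip m a z i Hi). assert (Hsq := spins_sqr m z i Hz Hi).
    assert (He := energy_flip m A z i Hs
      (fun k Hk => Req_le _ _ (spins_abs m z k Hz Hk)) Hi).
    set (x := lin m a z) in *. set (y := lin m a (upd z i (- z i))) in *.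
    assert (Hr : 0 < exp (-2 * lam)) by apply exp_pos.
    set (r := exp (-2 * lam)) in *.
    assert (W1 : 0 < ising_weight m A z) by apply ising_weight_pos.
    assert (W2 : 0 < ising_weight m A (upd z i (- z i))) by apply ising_weight_pos.
    assert (Hlam0 : 0 <= lam).
    { eapply Rle_trans; [|exact Hlam]. apply rsum_nonneg. intros; apply Rabs_pos. }
    assert (Hr1 : r <= 1).
    { unfold r. rewrite <- exp_0. apply exp_le_compat; lra. }
    assert (R1 : r * ising_weight m A z <= ising_weight m A (upd z i (- z i))).
    { unfold r, ising_weight. rewrite <- exp_plus. apply Rabs_le_between in He.
      unfold energy in He.
      apply exp_le_compat; lra. }
    assert (R2 : r * ising_weight m A (upd z i (- z i)) <= ising_weight m A z).
    { unfold r, ising_weight. rewrite <- exp_plus. apply Rabs_le_between in He.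
      unfold energy in He.
      apply exp_le_compat; lra. }
    set (W := ising_weight m A z) in *. set (W' := ising_weight m A (upd z i (- z i))) in *.
    assert (Hxy : (x - y) * (x - y) = 4 * (a i * a i)).
    { rewrite Hfl. transitivity (4 * (a i * a i) * (z i * z i)); [ring|rewrite Hsq; ring]. }
    (* [q] is a common lower bound for both weights, since [r * W' <= W], [r * W <= W'] and
       [r <= 1]. It then suffices that x^2 + y^2 >= (x - y)^2 / 2 = 2 a_i^2. *)
    set (q := r * (W + W') / 2).
    assert (q <= W) by (unfold q; nra). assert (q <= W') by (unfold q; nra).
    assert (0 < q) by (unfold q; nra).
    apply Rle_trans with (q * (x * x + y * y)).
    - assert (2 * (a i * a i) <= x * x + y * y).
      { assert (Hp := Rle_0_sqr (x + y)). unfold Rsqr in Hp. lra. }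
      replace (r * (a i * a i) * (W + W')) with (q * (2 * (a i * a i))) by (unfold q; field).
      apply Rmult_le_compat_l; lra.
    - assert (0 <= x * x) by apply Rle_0_sqr. assert (0 <= y * y) by apply Rle_0_sqr.
      nra. }
  rewrite !lsum_plus in H. rewrite H1, H2 in H. fold F. lra.
Qed.

(** * Mean of the estimator and of the excess *)

Lemma g_miss_factored (m : nat) (p w X : nat -> R) (i : nat) :
  (i < m)%nat ->
  g_miss (S m) p w X i
  = - (X m / (1 - p m))
    * rprod m (fun j => if Nat.eqb j i
                        then exp (- vv (S m) w j * X m * X j) * X j / (1 - p j)
                        else (exp (- vv (S m) w j * X m * X j) - p j) / (1 - p j)).
Proof.
  intros Hi. unfold g_miss. replace (S m - 1)%nat with m by lia.
  rewrite Rmult_assoc, rprod_extract by easy. f_equal. apply rprod_ext.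
  intros j _. destruct (Nat.eqb_spec j i); now subst.
Qed.

Lemma g_miss_depends (m : nat) (p w : nat -> R) (i : nat) :
  (i < m)%nat -> depends_below (S m) (fun X => g_miss (S m) p w X i).
Proof.
  intros Hi f g H. rewrite !g_miss_factored by easy. rewrite (H m) by lia. f_equal.
  apply rprod_ext. intros j Hj. rewrite (H j) by lia. easy.
Qed.

(* The estimator is unbiased for the gradient of [E exp (- Z_n <v, Z>)]: averaging
   [(exp (a C_j) - p_j) / (1 - p_j)] over the mask bit [C_j] gives [exp a]. *)
Lemma g_miss_mean (m : nat) (A : nat -> nat -> R) (p w : nat -> R) (i : nat) :
  (forall j, (j < S m)%nat -> 0 <= p j < 1) -> (i < m)%nat ->
  miss_mean (S m) A p (fun X => g_miss (S m) p w X i)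
  = lsum (fun z => ising_pr (S m) A z * (- z m * z i * exp (- z m * lin m (vv (S m) w) z)))
         (spins (S m)).
Proof.
  intros Hp Hi. rewrite miss_mean_expand by now apply g_miss_depends.
  apply lsum_ext_in. intros z _. f_equal. unfold bits. rewrite lsum_fenum_S.
  set (phi := fun j c => if Nat.eqb j i
     then exp (- vv (S m) w j * z m * (c * z j)) * (c * z j) / (1 - p j)
     else (exp (- vv (S m) w j * z m * (c * z j)) - p j) / (1 - p j)).
  assert (Hpm := Hp m ltac:(lia)).
  transitivity (- z m * lsum (fun c => mask_pr m p c * rprod m (fun j => phi j (c j))) (bits m)).
  - rewrite <- lsum_scal. apply lsum_ext_in. intros f _.
    cbn [lsum fold_right]. rewrite !g_miss_factored by easy. rewrite !upd_same.
    assert (M : mask_pr (S m) p (upd f m 1) = mask_pr m p f * (1 - p m)).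
    { unfold mask_pr. simpl. rewrite upd_same, Reqb_refl. f_equal.
      apply rprod_ext. intros j Hj. now rewrite upd_lt. }
    rewrite M.
    (* For [C_n = 0] the leading factor [X_n] kills the estimator. For [C_n = 1] the mask weight
       [1 - p m] will cancel the leading denominator. *)
    match goal with |- ?a * (?b * ?c) + _ = _ =>
      replace (a * (b * c)) with 0 by (field; lra) end.
    rewrite (rprod_ext m _ (fun j => phi j (f j))).
    + field. lra.
    + intros j Hj. unfold phi. rewrite upd_lt by easy. now rewrite Rmult_1_l.
  (* Averaging over [C_j] turns each debiased factor into a pure exponential. Slot [i] also acquires
     [z i], its value at [C_i = 0] being 0. *)
  - rewrite mask_rprod_mean.
    rewrite (rprod_ext m _ (fun j => (if Nat.eqb j i then z i else 1)
        * exp (- z m * (vv (S m) w j * z j)))).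
    + rewrite rprod_mult, rprod_exp, <- (rprod_extract m (fun _ => 1)) by easy.
      rewrite (rprod_ext m _ (fun _ => 1)), rprod_const1.
      * unfold lin. rewrite rsum_scal. ring.
      * intros j _. now destruct (Nat.eqb j i).
    + intros j Hj. unfold phi. specialize (Hp j ltac:(lia)).
      replace (- vv (S m) w j * z m * (0 * z j)) with 0 by ring.
      replace (- vv (S m) w j * z m * (1 * z j)) with (- z m * (vv (S m) w j * z j)) by ring.
      rewrite exp_0. destruct (Nat.eqb_spec j i) as [->|_]; field; lra.
Qed.

(** This is <w - u, G_miss (w; X)> for any [u] whose coordinate differences are the row [A m], so no
    particular lift appears in it. *)
Definition excess (m : nat) (A : nat -> nat -> R) (p w X : nat -> R) : R :=
  rsum m (fun k => (vv (S m) w k - A m k) * g_miss (S m) p w X k).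

Lemma miss_mean_rsum (n m : nat) (A : nat -> nat -> R) (p a : nat -> R)
  (F : nat -> (nat -> R) -> R) :
  miss_mean n A p (fun X => rsum m (fun k => a k * F k X))
  = rsum m (fun k => a k * miss_mean n A p (F k)).
Proof.
  unfold miss_mean.
  rewrite (rsum_ext m _ (fun k => lsum (fun x => a k * (miss_pr n A p x * F k x)) (cube n)))
    by (intros; now rewrite lsum_scal).
  rewrite rsum_lsum. apply lsum_ext_in. intros x _. rewrite <- rsum_scal.
  apply rsum_ext. intros; ring.
Qed.

(** For [x >= 0], exp x >= 1 + x and exp (-x) <= 1; the other sign is the mirror image. *)
Lemma sinh_mul_ge (x : R) : x * x <= x * (exp x - exp (- x)).
Proof.
  assert (H1 := exp_ineq1_le x). assert (H2 := exp_ineq1_le (- x)).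
  destruct (Rle_dec 0 x) as [Hx|Hx].
  - assert (exp (- x) <= 1).
    { rewrite exp_Ropp. rewrite <- Rinv_1. apply Rinv_le_contravar; lra. }
    nra.
  - assert (exp x <= 1).
    { replace x with (- - x) by ring. rewrite exp_Ropp. rewrite <- Rinv_1.
      apply Rinv_le_contravar; lra. }
    nra.
Qed.

(** Interaction screening: for [Z_n = c] the Ising weight contributes exp (c S) and the loss exp (-c
    V), with V = <v, Z> and V - S = D. They merge into exp (-c D), leaving the model on the other
    [m] vertices. *)
Lemma excess_mean_eq (m : nat) (A : nat -> nat -> R) (p w : nat -> R) :
  (forall i j, (i < S m)%nat -> (j < S m)%nat -> A i j = A j i) ->
  (forall j, (j < S m)%nat -> 0 <= p j < 1) ->
  let D := lin m (fun k => vv (S m) w k - A m k) in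
  miss_mean (S m) A p (excess m A p w)
  = / lsum (ising_weight (S m) A) (spins (S m)) *
    lsum (fun z => ising_weight m A z * (D z * (exp (D z) - exp (- D z)))) (spins m).
Proof.
  intros Hs Hp D.
  unfold excess at 1. rewrite miss_mean_rsum.
  rewrite (rsum_ext m _ (fun k => lsum (fun z => (vv (S m) w k - A m k) *
    (ising_pr (S m) A z * (- z m * z k * exp (- z m * lin m (vv (S m) w) z)))) (spins (S m))))
    by (intros k Hk; now rewrite g_miss_mean, lsum_scal).
  rewrite rsum_lsum. unfold ising_pr.
  set (Zp := lsum (ising_weight (S m) A) (spins (S m))).
  assert (HZ : 0 < Zp) by apply ising_partition_pos.
  transitivity (lsum (fun z => / Zp * (ising_weight (S m) A z *
     (- z m * exp (- z m * lin m (vv (S m) w) z) * D z))) (spins (S m))).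
  - apply lsum_ext_in. intros z _. unfold D, lin at 3.
    rewrite <- !rsum_scal. apply rsum_ext. intros k _. field. lra.
  - rewrite lsum_scal. f_equal. unfold spins. rewrite lsum_fenum_S.
    apply lsum_ext_in. intros f _. cbn [lsum fold_right].
    rewrite !ising_weight_S by easy. rewrite !upd_same. unfold D. rewrite !lin_upd.
    rewrite lin_sub. set (V := lin m (vv (S m) w) f). set (U := lin m (A m) f).
    replace (V - U) with (V + - U) by ring.
    replace (- (V + - U)) with (- V + U) by ring.
    rewrite !exp_plus.
    replace (- -1 * V) with V by ring. replace (- (1) * V) with (- V) by ring.
    replace (-1 * U) with (- U) by ring. replace (1 * U) with U by ring. ring.
Qed.

(** The exponent 3 is 2 from resampling one spin plus 1 from the partition functions: summing out
    the last spin multiplies a weight by 2 cosh S <= 2 exp lam. That 2 is the denominator of the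
    bound. *)
Lemma excess_mean_ge (m : nat) (A : nat -> nat -> R) (p w : nat -> R) (lam : R) (i : nat) :
  (forall i j, (i < S m)%nat -> (j < S m)%nat -> A i j = A j i) ->
  (forall i, (i < S m)%nat -> rsum (S m) (fun j => Rabs (A i j)) <= lam) ->
  (forall j, (j < S m)%nat -> 0 <= p j < 1) -> (i < m)%nat ->
  exp (-3 * lam) / 2 * ((vv (S m) w i - A m i) * (vv (S m) w i - A m i))
  <= miss_mean (S m) A p (excess m A p w).
Proof.
  intros Hs Hlam Hp Hi. rewrite excess_mean_eq by easy.
  set (a := fun k => vv (S m) w k - A m k). fold (a i).
  set (W0 := lsum (ising_weight m A) (spins m)).
  set (Z := lsum (ising_weight (S m) A) (spins (S m))).
  assert (HW : 0 < W0) by apply ising_partition_pos.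
  assert (HZ : 0 < Z) by apply ising_partition_pos.
  assert (Hrow : forall k, (k < S m)%nat -> rsum m (fun j => Rabs (A k j)) <= lam).
  { intros k Hk. specialize (Hlam k Hk). simpl in Hlam.
    assert (0 <= Rabs (A k m)) by apply Rabs_pos. lra. }
  assert (HZW : Z <= 2 * exp lam * W0).
  { unfold Z, W0, spins. rewrite lsum_fenum_S, <- lsum_scal. apply lsum_le_in.
    intros f Hf. cbn [lsum fold_right]. rewrite !ising_weight_S by easy.
    assert (Hb := lin_abs_le m (A m) f (fun k Hk => Req_le _ _ (spins_abs m f k Hf Hk))).
    specialize (Hrow m ltac:(lia)). apply Rabs_le_between in Hb.
    assert (exp (-1 * lin m (A m) f) <= exp lam) by (apply exp_le_compat; lra).
    assert (exp (1 * lin m (A m) f) <= exp lam) by (apply exp_le_compat; lra).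
    assert (0 < ising_weight m A f) by apply ising_weight_pos. nra. }
  assert (HS : exp (-2 * lam) * (a i * a i) * W0 <=
    lsum (fun z => ising_weight m A z * (lin m a z * (exp (lin m a z) - exp (- lin m a z)))) (spins m)).
  { eapply Rle_trans.
    - apply (ising_second_moment m A lam a i); [intros; apply Hs; lia|easy|apply Hrow; lia].
    - apply lsum_le_in. intros z _. apply Rmult_le_compat_l; [left; apply ising_weight_pos|].
      apply sinh_mul_ge. }
  apply Rle_trans with (/ Z * (exp (-2 * lam) * (a i * a i) * W0)).
  - assert (E : exp (-2 * lam) = exp (-3 * lam) * exp lam)
      by (rewrite <- exp_plus; f_equal; ring).
    rewrite E. assert (0 < exp (-3 * lam)) by apply exp_pos.
    assert (0 <= a i * a i) by apply Rle_0_sqr.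
    apply (Rmult_le_reg_l Z); [easy|].
    replace (Z * (/ Z * (exp (-3 * lam) * exp lam * (a i * a i) * W0)))
      with (exp (-3 * lam) / 2 * (a i * a i) * (2 * exp lam * W0)) by (field; lra).
    rewrite (Rmult_comm Z). apply Rmult_le_compat_l; [|easy].
    apply Rmult_le_pos; lra.
  - apply Rmult_le_compat_l; [left; now apply Rinv_0_lt_compat|easy].
Qed.

(** * Bounds on the estimator *)

Lemma exp_convex_one (s y : R) : 0 <= s <= 1 -> exp (s * y) <= 1 - s + s * exp y.
Proof.
  intros Hs.
  (* tangent line of exp at [s * y], evaluated at [0] and at [y] *)
  assert (H0 : exp (s * y) * (1 - s * y) <= 1).
  { assert (H := exp_ineq1_le (- (s * y))). rewrite exp_Ropp in H.
    assert (Hp := exp_pos (s * y)).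
    apply (Rmult_le_compat_l (exp (s * y))) in H; [|lra].
    rewrite Rinv_r in H by lra. lra. }
  assert (H1 : exp (s * y) * (1 + (y - s * y)) <= exp y).
  { assert (H := exp_ineq1_le (y - s * y)). assert (Hp := exp_pos (s * y)).
    replace (exp y) with (exp (s * y) * exp (y - s * y))
      by (rewrite <- exp_plus; f_equal; ring).
    apply Rmult_le_compat_l; lra. }
  apply (Rmult_le_compat_l (1 - s)) in H0; [|lra].
  apply (Rmult_le_compat_l s) in H1; [|lra]. lra.
Qed.

(** From above, convexity with [s = 1 - p] gives exp a <= p + (1 - p) exp (|a| / (1 - p)). From
    below, tangent lines suffice. A bound of the form exp (c |a|) multiplies over coordinates
    without any dimension factor. *)
Lemma debiased_exp_bound (a p : R) :
  0 <= p < 1 -> Rabs ((exp a - p) / (1 - p)) <= exp (Rabs a / (1 - p)).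
Proof.
  intros Hp. assert (Ha := Rle_abs a). assert (Ha' := Rle_abs (- a)).
  rewrite Rabs_Ropp in Ha'.
  assert (Hi : 0 < / (1 - p)) by (apply Rinv_0_lt_compat; lra).
  assert (E : exp a <= p + (1 - p) * exp (Rabs a / (1 - p))).
  { apply Rle_trans with (exp ((1 - p) * (Rabs a / (1 - p)))).
    - apply exp_le_compat. replace ((1 - p) * (Rabs a / (1 - p))) with (Rabs a); [easy|field; lra].
    - eapply Rle_trans; [apply exp_convex_one; lra|lra]. }
  assert (E' : p - exp a <= (1 - p) * exp (Rabs a / (1 - p))).
  { assert (H1 := exp_ineq1_le a). assert (H2 := exp_ineq1_le (Rabs a / (1 - p))).
    apply (Rmult_le_compat_l (1 - p)) in H2; [|lra].
    replace ((1 - p) * (1 + Rabs a / (1 - p))) with (1 - p + Rabs a) in H2 by (field; lra).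
    lra. }
  apply Rabs_le. split.
  - apply (Rmult_le_reg_l (1 - p)); [lra|].
    replace ((1 - p) * ((exp a - p) / (1 - p))) with (exp a - p) by (field; lra). lra.
  - apply (Rmult_le_reg_l (1 - p)); [lra|].
    replace ((1 - p) * ((exp a - p) / (1 - p))) with (exp a - p) by (field; lra). lra.
Qed.

Lemma cube_abs_le (k : nat) (x : nat -> R) (i : nat) :
  In x (cube k) -> (i < k)%nat -> Rabs (x i) <= 1.
Proof.
  intros Hx Hi. destruct (fenum_in _ _ _ _ i Hx Hi) as [<-|[<-|[<-|[]]]];
    apply Rabs_le; lra.
Qed.

(** Only two denominators remain outside the exponent, those of [X_n] and of slot [i], hence the
    square. All others become part of exp (lam / (1 - pm)) through the l1 bound on [v]. *)
Lemma g_miss_abs_le (m : nat) (p w X : nat -> R) (i : nat) (lam pm : R) :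
  (forall j, (j < S m)%nat -> 0 <= p j <= pm) -> pm < 1 ->
  (forall j, (j < S m)%nat -> Rabs (X j) <= 1) ->
  rsum m (fun j => Rabs (vv (S m) w j)) <= lam -> (i < m)%nat ->
  Rabs (g_miss (S m) p w X i) <= / (1 - pm) ^ 2 * exp (lam / (1 - pm)).
Proof.
  intros Hp Hpm HX Hw Hi.
  set (q := 1 - pm). assert (Hq : 0 < q) by (unfold q; lra).
  assert (Hiq : 0 < / q) by now apply Rinv_0_lt_compat.
  assert (Hinv : forall j, (j < S m)%nat -> 0 < / (1 - p j) <= / q).
  { intros j Hj. specialize (Hp j Hj). split; [apply Rinv_0_lt_compat; unfold q in *; lra|].
    apply Rinv_le_contravar; unfold q in *; lra. }
  assert (Hexp : forall j, (j < m)%nat ->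
    Rabs (- vv (S m) w j * X m * X j) <= Rabs (vv (S m) w j)).
  { intros j Hj. rewrite !Rabs_mult, Rabs_Ropp.
    assert (H1 := HX m ltac:(lia)). assert (H2 := HX j ltac:(lia)).
    assert (0 <= Rabs (vv (S m) w j)) by apply Rabs_pos.
    assert (0 <= Rabs (X m)) by apply Rabs_pos. assert (0 <= Rabs (X j)) by apply Rabs_pos.
    assert (Rabs (X m) * Rabs (X j) <= 1) by nra. nra. }
  unfold g_miss. replace (S m - 1)%nat with m by lia.
  set (a := exp (- vv (S m) w i * X m * X i) * X i / (1 - p i)).
  set (P := rprod m _).
  (* The extra [q] cancels the denominator of slot [i], so that this slot obeys the same exponential
     bound as the others. *)
  assert (HP : q * Rabs (a * P) <= exp (lam / q)).
  { rewrite <- (Rabs_pos_eq q) at 1 by lra. rewrite <- Rabs_mult, <- Rmult_assoc.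
    unfold P. rewrite rprod_extract by easy.
    eapply Rle_trans; [apply (rprod_abs_le_exp m _ (fun j => / q * Rabs (vv (S m) w j)))|].
    - intros j Hj. specialize (Hexp j Hj). destruct (Nat.eqb_spec j i) as [->|_].
      + unfold a.
        specialize (Hinv i ltac:(lia)). specialize (HX i ltac:(lia)).
        apply Rle_trans with (exp (Rabs (vv (S m) w i))).
        * set (e := exp (- vv (S m) w i * X m * X i)).
          assert (He : e <= exp (Rabs (vv (S m) w i))).
          { apply exp_le_compat. eapply Rle_trans; [apply Rle_abs|easy]. }
          assert (He0 : 0 < e) by apply exp_pos.
          unfold Rdiv. rewrite !Rabs_mult.
          rewrite (Rabs_pos_eq q), (Rabs_pos_eq e), (Rabs_pos_eq (/ (1 - p i))) by lra.
          assert (q * / (1 - p i) <= 1).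
          { apply Rle_trans with (q * / q); [apply Rmult_le_compat_l; lra|rewrite Rinv_r; lra]. }
          assert (0 <= q * / (1 - p i)) by (apply Rmult_le_pos; lra).
          assert (0 <= Rabs (X i)) by apply Rabs_pos.
          replace (q * (e * Rabs (X i) * / (1 - p i)))
            with (e * (Rabs (X i) * (q * / (1 - p i)))) by ring.
          assert (Rabs (X i) * (q * / (1 - p i)) <= 1) by nra. nra.
        * apply exp_le_compat. assert (0 <= Rabs (vv (S m) w i)) by apply Rabs_pos.
          assert (1 <= / q).
          { rewrite <- Rinv_1. apply Rinv_le_contravar; [easy|].
            specialize (Hp i ltac:(lia)). unfold q; lra. }
          nra.
      + eapply Rle_trans; [apply debiased_exp_bound; specialize (Hp j ltac:(lia)); lra|].
        apply exp_le_compat. specialize (Hinv j ltac:(lia)). unfold Rdiv.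
        rewrite Rmult_comm. apply Rmult_le_compat; try lra. apply Rabs_pos.
    - apply exp_le_compat. rewrite rsum_scal. unfold Rdiv. rewrite Rmult_comm.
      apply Rmult_le_compat_r; lra. }
  rewrite Rmult_assoc, Rabs_mult, Rabs_Ropp. unfold Rdiv at 1. rewrite Rabs_mult.
  specialize (Hinv m ltac:(lia)). specialize (HX m ltac:(lia)).
  rewrite (Rabs_pos_eq (/ (1 - p m))) by lra.
  assert (HXm : 0 <= Rabs (X m)) by apply Rabs_pos.
  assert (Rabs (X m) * / (1 - p m) <= / q) by nra.
  apply Rle_trans with (/ q * Rabs (a * P)).
  - apply Rmult_le_compat_r; [apply Rabs_pos|easy].
  - replace (/ q ^ 2 * exp (lam / q)) with (/ q * (/ q * exp (lam / q))) by (field; lra).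
    apply Rmult_le_compat_l; [lra|].
    apply (Rmult_le_reg_l q); [easy|].
    replace (q * (/ q * exp (lam / q))) with (exp (lam / q)) by (field; lra). easy.
Qed.

(** * Multiplicative weights *)

(** Exponentiated and inverted, it reduces to 1 <= (1 + x)(1 - x + 2 x^2) = 1 + x^2 (1 + 2 x). *)
Lemma ln_1p_ge (x : R) : Rabs x <= / 4 -> x - 2 * (x * x) <= ln (1 + x).
Proof.
  intros Hx. apply Rabs_le_between in Hx.
  assert (H : exp (x - 2 * (x * x)) <= 1 + x).
  { assert (He := exp_ineq1_le (- (x - 2 * (x * x)))). rewrite exp_Ropp in He.
    assert (Hp := exp_pos (x - 2 * (x * x))).
    set (e := exp (x - 2 * (x * x))) in *.
    apply (Rmult_le_compat_l e) in He; [|lra]. rewrite Rinv_r in He by lra.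
    assert (Hq : 0 < 1 - x + 2 * (x * x)) by nra.
    assert (Hc : 1 <= (1 + x) * (1 - x + 2 * (x * x))).
    { assert (0 <= x * x) by apply Rle_0_sqr. nra. }
    apply (Rmult_le_reg_r (1 - x + 2 * (x * x))); [easy|]. nra. }
  rewrite <- (ln_exp (x - 2 * (x * x))).
  destruct (Rle_lt_or_eq_dec _ _ H) as [L|E]; [|rewrite E; lra].
  left. apply ln_increasing; [apply exp_pos|easy].
Qed.

(** [smg_step] with the gradient abstracted; the two are convertible, which the inductions on
    iterates rely on. *)
Definition mw_update (N : nat) (lam eta : R) (w G : nat -> R) : nat -> R :=
  let C := rsum N (fun k => w k * G k) / lam in
  fun k => w k * (1 - eta * G k + eta * C).

Lemma rsum_mul_abs_le (N : nat) (w G : nat -> R) (B : R) :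
  (forall k, (k < N)%nat -> 0 <= w k) -> (forall k, (k < N)%nat -> Rabs (G k) <= B) ->
  Rabs (rsum N (fun k => w k * G k)) <= rsum N w * B.
Proof.
  intros Hw HG. eapply Rle_trans; [apply rsum_abs|].
  rewrite Rmult_comm, <- rsum_scal. apply rsum_le. intros k Hk.
  rewrite Rabs_mult, (Rabs_pos_eq (w k)) by auto. rewrite Rmult_comm.
  apply Rmult_le_compat_r; auto.
Qed.

Lemma mw_update_rel_small (N : nat) (lam eta B : R) (w G : nat -> R) (k : nat) :
  0 < lam -> 0 <= eta -> (forall k, (k < N)%nat -> 0 < w k) -> rsum N w = lam ->
  (forall k, (k < N)%nat -> Rabs (G k) <= B) -> (k < N)%nat ->
  Rabs (eta * (rsum N (fun k => w k * G k) / lam - G k)) <= 2 * (eta * B).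
Proof.
  intros Hl He Hw Hs HG Hk.
  assert (HC : Rabs (rsum N (fun k => w k * G k) / lam) <= B).
  { unfold Rdiv. rewrite Rabs_mult, (Rabs_pos_eq (/ lam))
      by (left; now apply Rinv_0_lt_compat).
    apply (Rmult_le_reg_r lam); [easy|]. rewrite Rmult_assoc, Rinv_l, Rmult_1_r by lra.
    rewrite (Rmult_comm B). rewrite <- Hs.
    apply rsum_mul_abs_le; [intros; left; auto|auto]. }
  rewrite Rabs_mult, (Rabs_pos_eq eta) by easy.
  specialize (HG k Hk).
  assert (Rabs (rsum N (fun k => w k * G k) / lam - G k) <= 2 * B).
  { apply Rabs_le_between in HC. apply Rabs_le_between in HG. apply Rabs_le; lra. }
  nra.
Qed.

(** [C] is the [w]-average of [G], so the changes of mass cancel exactly; relative changes are at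
    most [2 * (eta * B)], hence at most 1/4, and weights stay positive. *)
Lemma mw_update_simplex (N : nat) (lam eta B : R) (w G : nat -> R) :
  0 < lam -> 0 <= eta -> eta * B <= / 8 ->
  (forall k, (k < N)%nat -> 0 < w k) -> rsum N w = lam ->
  (forall k, (k < N)%nat -> Rabs (G k) <= B) ->
  (forall k, (k < N)%nat -> 0 < mw_update N lam eta w G k)
  /\ rsum N (mw_update N lam eta w G) = lam.
Proof.
  intros Hl He HB Hw Hs HG. split.
  - intros k Hk. unfold mw_update. apply Rmult_lt_0_compat; [auto|].
    assert (H := mw_update_rel_small N lam eta B w G k Hl He Hw Hs HG Hk).
    apply Rabs_le_between in H. lra.
  - unfold mw_update. set (c := rsum N (fun k => w k * G k)).
    rewrite (rsum_ext N _ (fun k => (1 + eta * (c / lam)) * w k - eta * (w k * G k)))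
      by (intros; ring).
    rewrite rsum_minus, !rsum_scal, Hs. fold c. field. lra.
Qed.

(** The potential, the sum of u_k ln w_k, is minus the relative entropy of [u] to [w] up to a
    constant. One update adds u_k ln (1 + x_k) with x_k = eta (C - G_k); the linear part sums to the
    left side, and 2 x_k^2 <= 8 (eta B)^2 is the loss. *)
Lemma mw_update_potential (N : nat) (lam eta B : R) (w G u : nat -> R) :
  0 < lam -> 0 <= eta -> eta * B <= / 8 ->
  (forall k, (k < N)%nat -> 0 < w k) -> rsum N w = lam ->
  (forall k, (k < N)%nat -> Rabs (G k) <= B) ->
  (forall k, (k < N)%nat -> 0 <= u k) -> rsum N u = lam ->
  eta * rsum N (fun k => (w k - u k) * G k)
  <= rsum N (fun k => u k * ln (mw_update N lam eta w G k)) - rsum N (fun k => u k * ln (w k))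
     + 8 * lam * (eta * B) ^ 2.
Proof.
  intros Hl He HB Hw Hs HG Hu Hus.
  set (c := rsum N (fun k => w k * G k) / lam).
  assert (E : eta * rsum N (fun k => (w k - u k) * G k)
              = rsum N (fun k => u k * (eta * (c - G k)))).
  { rewrite (rsum_ext N (fun k => (w k - u k) * G k) (fun k => w k * G k - u k * G k))
      by (intros; ring).
    rewrite (rsum_ext N (fun k => u k * (eta * (c - G k)))
               (fun k => eta * c * u k - eta * (u k * G k))) by (intros; ring).
    rewrite !rsum_minus, !rsum_scal, Hus. unfold c. field. lra. }
  rewrite E. replace (8 * lam * (eta * B) ^ 2) with (8 * (eta * B) ^ 2 * rsum N u)
    by (rewrite Hus; ring).
  rewrite <- rsum_scal, <- rsum_minus, <- rsum_plus.
  apply rsum_le. intros k Hk.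
  assert (Hx := mw_update_rel_small N lam eta B w G k Hl He Hw Hs HG Hk). fold c in Hx.
  unfold mw_update. fold c.
  set (x := eta * (c - G k)) in *.
  replace (1 - eta * G k + eta * c) with (1 + x) by (unfold x; ring).
  assert (Hx2 : x * x <= 4 * (eta * B) ^ 2).
  { replace (4 * (eta * B) ^ 2) with ((2 * (eta * B)) * (2 * (eta * B))) by ring.
    apply Rabs_le_between in Hx. nra. }
  assert (Hln := ln_1p_ge x ltac:(lra)).
  apply Rabs_le_between in Hx.
  rewrite ln_mult by (try lra; auto).
  specialize (Hu k Hk). nra.
Qed.

(** * Regret of the iterates *)

(** The two halves of the gradient are opposite and its last coordinate is 0, so it sees only
    coordinate differences. *)
Lemma G_miss_inner (m : nat) (p w X a : nat -> R) :
  rsum (2 * S m - 1) (fun k => a k * G_miss (S m) p w X k)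
  = rsum m (fun k => (a k - a (m + k)%nat) * g_miss (S m) p w X k).
Proof.
  replace (2 * S m - 1)%nat with (S (m + m)) by lia. cbn [rsum].
  unfold G_miss. replace (2 * S m - 2)%nat with (m + m)%nat by lia.
  replace (S m - 1)%nat with m by lia.
  replace (Nat.ltb (m + m) m) with false by (symmetry; apply Nat.ltb_ge; lia).
  rewrite Nat.ltb_irrefl, Rmult_0_r, Rplus_0_r, rsum_add, <- rsum_plus.
  apply rsum_ext. intros k Hk.
  replace (Nat.ltb k m) with true by (symmetry; apply Nat.ltb_lt; lia).
  replace (Nat.ltb (m + k) m) with false by (symmetry; apply Nat.ltb_ge; lia).
  replace (Nat.ltb (m + k) (m + m)) with true by (symmetry; apply Nat.ltb_lt; lia).
  replace (m + k - m)%nat with k by lia. ring.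
Qed.

Lemma G_miss_abs_le (m : nat) (p w X : nat -> R) (B : R) :
  0 <= B -> (forall i, (i < m)%nat -> Rabs (g_miss (S m) p w X i) <= B) ->
  forall k, Rabs (G_miss (S m) p w X k) <= B.
Proof.
  intros HB H k. unfold G_miss.
  destruct (Nat.ltb_spec k (S m - 1)); [apply H; lia|].
  destruct (Nat.ltb_spec k (2 * S m - 2)); [rewrite Rabs_Ropp; apply H; lia|].
  now rewrite Rabs_R0.
Qed.

Lemma vv_l1_le (m : nat) (w : nat -> R) :
  (forall k, (k < 2 * S m - 1)%nat -> 0 <= w k) ->
  rsum m (fun j => Rabs (vv (S m) w j)) <= rsum (2 * S m - 1) w.
Proof.
  replace (2 * S m - 1)%nat with (S (m + m)) by lia. intros Hw. cbn [rsum].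
  rewrite rsum_add, <- rsum_plus.
  assert (0 <= w (m + m)%nat) by (apply Hw; lia).
  assert (rsum m (fun j => Rabs (vv (S m) w j)) <= rsum m (fun i => w i + w (m + i)%nat)); [|lra].
  apply rsum_le. intros j Hj. unfold vv. replace (S m - 1)%nat with m by lia.
  assert (0 <= w j) by (apply Hw; lia). assert (0 <= w (m + j)%nat) by (apply Hw; lia).
  apply Rabs_le; lra.
Qed.

(* Positive and negative parts of [a], the last coordinate taking up the slack. *)
Definition simplex_lift (m : nat) (lam : R) (a : nat -> R) : nat -> R :=
  fun k => if Nat.ltb k m then Rmax (a k) 0
           else if Nat.ltb k (m + m) then Rmax (- a (k - m)%nat) 0
           else lam - rsum m (fun j => Rabs (a j)).

Lemma simplex_lift_spec (m : nat) (lam : R) (a : nat -> R) :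
  rsum m (fun j => Rabs (a j)) <= lam ->
  (forall k, (k < 2 * S m - 1)%nat -> 0 <= simplex_lift m lam a k)
  /\ rsum (2 * S m - 1) (simplex_lift m lam a) = lam
  /\ (forall k, (k < m)%nat ->
        simplex_lift m lam a k - simplex_lift m lam a (m + k)%nat = a k).
Proof.
  intros Ha. unfold simplex_lift.
  assert (H1 : forall k, (k < m)%nat -> Nat.ltb k m = true) by (intros; apply Nat.ltb_lt; lia).
  assert (H2 : forall k, Nat.ltb (m + k) m = false) by (intros; apply Nat.ltb_ge; lia).
  assert (H3 : forall k, (k < m)%nat -> Nat.ltb (m + k) (m + m) = true)
    by (intros; apply Nat.ltb_lt; lia).
  assert (H4 : forall k, (m + k - m)%nat = k) by lia.
  repeat split.
  - intros k _. destruct (Nat.ltb k m); [apply Rmax_r|].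
    destruct (Nat.ltb k (m + m)); [apply Rmax_r|lra].
  - replace (2 * S m - 1)%nat with (S (m + m)) by lia. cbn [rsum].
    rewrite H2, Nat.ltb_irrefl, rsum_add, <- rsum_plus.
    rewrite (rsum_ext m _ (fun j => Rabs (a j))); [ring|].
    intros k Hk. rewrite H1, H2, H3, H4 by easy.
    unfold Rmax, Rabs. destruct (Rle_dec (a k) 0), (Rle_dec (- a k) 0), (Rcase_abs (a k)); lra.
  - intros k Hk. rewrite H1, H2, H3, H4 by easy.
    unfold Rmax. destruct (Rle_dec (a k) 0), (Rle_dec (- a k) 0); lra.
Qed.

Definition grad_bound (lam pm : R) : R := / (1 - pm) ^ 2 * exp (lam / (1 - pm)).

Lemma grad_bound_pos (lam pm : R) : pm < 1 -> 0 < grad_bound lam pm.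
Proof.
  intros H. apply Rmult_lt_0_compat; [|apply exp_pos].
  apply Rinv_0_lt_compat, pow_lt. lra.
Qed.

Lemma g_miss_simplex_le (m : nat) (p w X : nat -> R) (i : nat) (lam pm : R) :
  (forall j, (j < S m)%nat -> 0 <= p j <= pm) -> pm < 1 -> In X (cube (S m)) ->
  (forall k, (k < 2 * S m - 1)%nat -> 0 <= w k) -> rsum (2 * S m - 1) w = lam ->
  (i < m)%nat -> Rabs (g_miss (S m) p w X i) <= grad_bound lam pm.
Proof.
  intros Hp Hpm HX Hw Hs Hi. apply g_miss_abs_le; try easy.
  - intros j Hj. now apply (cube_abs_le (S m)).
  - rewrite <- Hs. now apply vv_l1_le.
Qed.

(** Iterate [t] uses samples [0] to [t - 1], so it is already fixed when sample [t] is drawn. *)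
Lemma smg_iterate_depends (n : nat) (p : nat -> R) (lam eta : R) (t : nat) :
  depends_below t (fun Xs => smg_iterate n p lam eta Xs t).
Proof.
  induction t as [|t IH]; intros f g H; simpl; [easy|].
  rewrite (IH f g) by (intros; apply H; lia). now rewrite H by lia.
Qed.

Lemma smg_iterate_simplex (m : nat) (p : nat -> R) (lam eta pm : R) (Xs : nat -> nat -> R) (t : nat) :
  0 < lam -> (forall j, (j < S m)%nat -> 0 <= p j <= pm) -> pm < 1 ->
  0 <= eta -> eta * grad_bound lam pm <= / 8 ->
  (forall s, (s < t)%nat -> In (Xs s) (cube (S m))) ->
  (forall k, (k < 2 * S m - 1)%nat -> 0 < smg_iterate (S m) p lam eta Xs t k)
  /\ rsum (2 * S m - 1) (smg_iterate (S m) p lam eta Xs t) = lam.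
Proof.
  intros Hl Hp Hpm He HB. induction t as [|t IH]; intros HX.
  - assert (0 < INR (2 * S m - 1)) by (apply lt_0_INR; lia). split.
    + intros k _. cbn [smg_iterate]. now apply Rdiv_lt_0_compat.
    + cbn [smg_iterate]. rewrite rsum_const. field. lra.
  - destruct IH as [Hw Hs]; [intros; apply HX; lia|].
    apply (mw_update_simplex _ lam eta (grad_bound lam pm)); try easy.
    intros k _. apply G_miss_abs_le; [left; now apply grad_bound_pos|]. intros i Hi.
    apply g_miss_simplex_le; try easy; [apply HX; lia|intros; left; auto].
Qed.

(** Telescoping the potential with [u] the lift of the row [A m]. It starts at lam (ln lam - ln N)
    for uniform weights and ends below lam ln lam because no weight exceeds [lam]. *)
Lemma smg_regret (m : nat) (A : nat -> nat -> R) (p : nat -> R) (lam eta pm : R)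
  (Xs : nat -> nat -> R) (T : nat) :
  0 < lam -> (forall j, (j < S m)%nat -> 0 <= p j <= pm) -> pm < 1 ->
  0 <= eta -> eta * grad_bound lam pm <= / 8 ->
  (forall s, (s < T)%nat -> In (Xs s) (cube (S m))) ->
  rsum m (fun j => Rabs (A m j)) <= lam ->
  eta * rsum T (fun t => excess m A p (smg_iterate (S m) p lam eta Xs t) (Xs t))
  <= lam * ln (INR (2 * S m - 1)) + INR T * (8 * lam * (eta * grad_bound lam pm) ^ 2).
Proof.
  intros Hl Hp Hpm He HB HX HA.
  set (N := (2 * S m - 1)%nat). set (B := grad_bound lam pm) in *.
  set (w := smg_iterate (S m) p lam eta Xs).
  destruct (simplex_lift_spec m lam (A m) HA) as [Hu [Hus Hua]].
  set (u := simplex_lift m lam (A m)) in *.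
  assert (HN : 0 < INR N) by (apply lt_0_INR; unfold N; lia).
  assert (Hind : forall k, (k <= T)%nat ->
    eta * rsum k (fun t => excess m A p (w t) (Xs t))
    <= rsum N (fun j => u j * ln (w k j)) - rsum N (fun j => u j * ln (w O j))
       + INR k * (8 * lam * (eta * B) ^ 2)).
  { induction k as [|k IH]; intros Hk; [simpl; lra|].
    specialize (IH ltac:(lia)). rewrite S_INR. cbn [rsum].
    destruct (smg_iterate_simplex m p lam eta pm Xs k) as [Hw Hs]; try easy.
    { intros; apply HX; lia. }
    assert (HXk := HX k ltac:(lia)).
    assert (Hpot := mw_update_potential N lam eta B (w k) (G_miss (S m) p (w k) (Xs k)) u
      Hl He HB Hw Hs).
    assert (HG : forall j, (j < N)%nat -> Rabs (G_miss (S m) p (w k) (Xs k) j) <= B).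
    { intros j _. apply G_miss_abs_le; [left; now apply grad_bound_pos|]. intros i Hi.
      apply g_miss_simplex_le; try easy. intros; left; auto. }
    specialize (Hpot HG Hu Hus).
    change (mw_update N lam eta (w k) (G_miss (S m) p (w k) (Xs k))) with (w (S k)) in Hpot.
    assert (E : rsum N (fun j => (w k j - u j) * G_miss (S m) p (w k) (Xs k) j)
                = excess m A p (w k) (Xs k)).
    { unfold N. rewrite (G_miss_inner m p (w k) (Xs k) (fun j => w k j - u j)).
      apply rsum_ext. intros j Hj. rewrite <- (Hua j Hj). unfold vv.
      replace (S m - 1)%nat with m by lia. ring. }
    rewrite E in Hpot. lra. }
  specialize (Hind T ltac:(lia)).
  assert (H0 : rsum N (fun j => u j * ln (w O j)) = lam * (ln lam - ln (INR N))).
  { rewrite (rsum_ext N _ (fun j => (ln lam - ln (INR N)) * u j)).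
    - rewrite rsum_scal. fold N in Hus. rewrite Hus. ring.
    - intros j _. unfold w. cbn [smg_iterate]. fold N. unfold Rdiv.
      rewrite ln_mult, ln_Rinv by (try easy; now apply Rinv_0_lt_compat). ring. }
  assert (HT : rsum N (fun j => u j * ln (w T j)) <= lam * ln lam).
  { apply Rle_trans with (rsum N (fun j => ln lam * u j)).
    - destruct (smg_iterate_simplex m p lam eta pm Xs T) as [Hw Hs]; try easy.
      apply rsum_le. intros j Hj. rewrite Rmult_comm. apply Rmult_le_compat_r; [now apply Hu|].
      assert (Hle : w T j <= lam).
      { rewrite <- Hs. fold w. apply (rsum_ge_term _ (w T) j); [intros; left; auto|easy]. }
      destruct Hle as [Hlt|Heq]; [|rewrite Heq; lra].
      left. apply ln_increasing; [now apply Hw|easy].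
    - rewrite rsum_scal. fold N in Hus. rewrite Hus. lra. }
  fold w. lra.
Qed.

Lemma excess_abs_le (m : nat) (A : nat -> nat -> R) (p w X : nat -> R) (lam pm : R) :
  (forall j, (j < S m)%nat -> 0 <= p j <= pm) -> pm < 1 -> In X (cube (S m)) ->
  (forall k, (k < 2 * S m - 1)%nat -> 0 <= w k) -> rsum (2 * S m - 1) w = lam ->
  rsum m (fun j => Rabs (A m j)) <= lam ->
  Rabs (excess m A p w X) <= 2 * lam * grad_bound lam pm.
Proof.
  intros Hp Hpm HX Hw Hs HA.
  assert (Hv := vv_l1_le m w Hw). rewrite Hs in Hv.
  assert (HB := grad_bound_pos lam pm Hpm).
  unfold excess. eapply Rle_trans; [apply rsum_abs|].
  apply Rle_trans with (rsum m (fun k =>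
    grad_bound lam pm * (Rabs (vv (S m) w k) + Rabs (A m k)))).
  - apply rsum_le. intros k Hk. rewrite Rabs_mult, Rmult_comm.
    apply Rmult_le_compat; try apply Rabs_pos.
    + now apply g_miss_simplex_le.
    + unfold Rminus. rewrite <- (Rabs_Ropp (A m k)). apply Rabs_triang.
  - rewrite rsum_scal, rsum_plus. nra.
Qed.

Lemma miss_mean_abs_le (n : nat) (A : nat -> nat -> R) (p : nat -> R)
  (F : (nat -> R) -> R) (c : R) :
  (forall i, (i < n)%nat -> 0 <= p i < 1) ->
  (forall x, In x (cube n) -> Rabs (F x) <= c) -> Rabs (miss_mean n A p F) <= c.
Proof.
  intros Hp HF. unfold miss_mean.
  assert (E : forall b, lsum (fun x => b * miss_pr n A p x) (cube n) = b)
    by (intros b; rewrite lsum_scal, miss_pr_total; ring).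
  apply Rabs_le. rewrite <- (E (- c)), <- (E c) at 1. split; apply lsum_le_in; intros x Hx;
    assert (H := HF x Hx); apply Rabs_le_between in H;
    assert (H0 := miss_pr_nonneg n A p x Hp); nra.
Qed.

(** * Concentration *)

(** In this form the linear term vanishes under a centered law, leaving a Gaussian-type bound. For
    [x <= 1] the right side is at least 1 + x + 2 x^2; for [x > 1], x <= 2 x^2. *)
Lemma exp_le_id_plus_exp_sqr (x : R) : exp x <= x + exp (2 * (x * x)).
Proof.
  assert (H0 := exp_ineq1_le (2 * (x * x))).
  assert (Hx2 : 0 <= x * x) by apply Rle_0_sqr.
  assert (Hpx := exp_pos x).
  destruct (Rle_dec x 0) as [Hneg|Hpos].
  - assert (H1 := exp_ineq1_le (- x)). rewrite exp_Ropp in H1.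
    apply (Rmult_le_compat_l (exp x)) in H1; [|lra]. rewrite Rinv_r in H1 by lra.
    assert (1 <= (1 + x + x * x) * (1 - x)) by nra.
    assert (exp x <= 1 + x + x * x); [|lra].
    apply (Rmult_le_reg_r (1 - x)); lra.
  - destruct (Rle_dec x 1) as [H1|H1].
    + assert (He := exp_ineq1_le (- (x / 2))).
      assert (E : exp x * (exp (- (x / 2)) * exp (- (x / 2))) = 1)
        by (rewrite <- !exp_plus, <- exp_0; f_equal; field).
      assert (Hsq : (1 - x / 2) * (1 - x / 2) <= exp (- (x / 2)) * exp (- (x / 2)))
        by (apply Rmult_le_compat; lra).
      apply (Rmult_le_compat_l (exp x)) in Hsq; [|lra]. rewrite E in Hsq.
      assert (Hpol : 1 <= (1 + x + 2 * (x * x)) * ((1 - x / 2) * (1 - x / 2))).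
      { replace ((1 + x + 2 * (x * x)) * ((1 - x / 2) * (1 - x / 2)))
          with (1 + (x * x) * ((1 - x) * (5 / 2 - x)) / 2) by field.
        assert (0 <= (1 - x) * (5 / 2 - x)) by (apply Rmult_le_pos; lra).
        assert (0 <= (x * x) * ((1 - x) * (5 / 2 - x))) by (now apply Rmult_le_pos). lra. }
      assert (exp x <= 1 + x + 2 * (x * x)); [|lra].
      apply (Rmult_le_reg_r ((1 - x / 2) * (1 - x / 2))); [|lra].
      apply Rmult_lt_0_compat; lra.
    + assert (exp x <= exp (2 * (x * x))) by (apply exp_le_compat; nra). lra.
Qed.

(** [D t] sees the past and the fresh sample separately. Summing out the last sample with its
    history fixed costs a factor exp (2 (s c)^2). Histories are restricted to [vals] because the
    bound on the increments holds only there. *)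
Lemma azuma_exp_moment {X : Type} (vals : list X) (d : X) (mu : X -> R)
  (D : nat -> (nat -> X) -> X -> R) (c s : R) (T : nat) :
  (forall x, In x vals -> 0 <= mu x) -> lsum mu vals = 1 ->
  (forall t, depends_below t (D t)) ->
  (forall t f, (t < T)%nat -> (forall i, (i < t)%nat -> In (f i) vals) ->
     lsum (fun x => mu x * D t f x) vals = 0
     /\ forall x, In x vals -> Rabs (D t f x) <= c) ->
  lsum (fun f => rprod T (fun t => mu (f t)) * exp (s * rsum T (fun t => D t f (f t))))
       (fenum vals d T)
  <= exp (INR T * (2 * ((s * c) * (s * c)))).
Proof.
  intros Hmu Htot Hdep. induction T as [|T IH]; intros HD.
  - simpl. rewrite Rmult_0_l, Rmult_0_r, exp_0. lra.
  - rewrite lsum_fenum_S, S_INR.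
    replace ((INR T + 1) * (2 * (s * c * (s * c))))
      with (2 * (s * c * (s * c)) + INR T * (2 * (s * c * (s * c)))) by ring.
    rewrite exp_plus. set (K := exp (2 * (s * c * (s * c)))).
    assert (HK : 0 < K) by apply exp_pos.
    eapply Rle_trans; [|apply Rmult_le_compat_l; [lra|apply IH; intros; apply HD; [lia|easy]]].
    rewrite <- lsum_scal. apply lsum_le_in. intros f Hf.
    assert (Hin : forall i, (i < T)%nat -> In (f i) vals) by (intros; now apply (fenum_in vals d T)).
    destruct (HD T f ltac:(lia) Hin) as [Hmean Hbd].
    set (P := rprod T (fun t => mu (f t))). set (Q := exp (s * rsum T (fun t => D t f (f t)))).
    assert (HP : 0 <= P) by (apply rprod_nonneg; auto).
    assert (HQ : 0 < Q) by apply exp_pos.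
    rewrite (lsum_ext_in _ (fun x => P * Q * (mu x * exp (s * D T f x)))).
    + rewrite lsum_scal, (Rmult_comm K). apply Rmult_le_compat_l; [nra|].
      apply Rle_trans with (lsum (fun x => s * (mu x * D T f x) + K * mu x) vals).
      * apply lsum_le_in. intros x Hx. specialize (Hbd x Hx). specialize (Hmu x Hx).
        assert (H1 := exp_le_id_plus_exp_sqr (s * D T f x)).
        assert (H2 : exp (2 * (s * D T f x * (s * D T f x))) <= K).
        { apply exp_le_compat. apply Rabs_le_between in Hbd.
          assert (D T f x * D T f x <= c * c) by nra.
          assert (0 <= s * s) by apply Rle_0_sqr. nra. }
        apply Rle_trans with (mu x * (s * D T f x + K)); [|lra].
        apply Rmult_le_compat_l; lra.
      * rewrite lsum_plus, !lsum_scal, Hmean, Htot. lra.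
    + intros x _. cbn [rsum rprod]. rewrite upd_same.
      rewrite (rprod_ext T _ (fun t => mu (f t))) by (intros; now rewrite upd_lt).
      rewrite (rsum_ext T _ (fun t => D t f (f t))).
      * rewrite (Hdep T (upd f T x) f) by (intros; now apply upd_lt).
        rewrite Rmult_plus_distr_l, exp_plus. fold P Q. ring.
      * intros t Ht. rewrite upd_lt by easy.
        rewrite (Hdep t (upd f T x) f); [easy|]. intros; apply upd_lt; lia.
Qed.

(** At the failing coordinate, Cauchy-Schwarz over time makes the squared errors of the iterates sum
    to at least T eps^2, and curvature applies at each time. *)
Lemma smg_failure_excess (m : nat) (A : nat -> nat -> R) (p : nat -> R) (lam eta eps : R)
  (T : nat) (Xs : nat -> nat -> R) :
  (forall i j, (i < S m)%nat -> (j < S m)%nat -> A i j = A j i) ->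
  (forall i, (i < S m)%nat -> rsum (S m) (fun j => Rabs (A i j)) <= lam) ->
  (forall j, (j < S m)%nat -> 0 <= p j < 1) -> 0 < eps -> (0 < T)%nat ->
  smg_success (S m) A eps (smg_output (S m) p lam eta T Xs) = false ->
  exp (-3 * lam) / 2 * (INR T * (eps * eps))
  <= rsum T (fun t => miss_mean (S m) A p (excess m A p (smg_iterate (S m) p lam eta Xs t))).
Proof.
  intros Hs Hlam Hp Heps HT Hf. unfold smg_success in Hf.
  apply rall_false in Hf. destruct Hf as [i [Hi Hf]].
  replace (S m - 1)%nat with m in * by lia.
  destruct (Rle_dec _ eps) as [|Hgt] in Hf; [easy|]. clear Hf.
  apply Rnot_le_lt in Hgt.
  assert (HTp : 0 < INR T) by now apply lt_0_INR.
  set (e := fun t => vv (S m) (smg_iterate (S m) p lam eta Xs t) i - A m i).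
  assert (E : smg_output (S m) p lam eta T Xs i - smg_output (S m) p lam eta T Xs (m + i)
              - A m i = / INR T * rsum T e).
  { unfold smg_output, e, vv. replace (S m - 1)%nat with m by lia.
    rewrite !rsum_minus, rsum_const. field. lra. }
  rewrite E in Hgt.
  assert (Hcs := rsum_square_le T e).
  assert (Hsq : INR T * (eps * eps) <= rsum T (fun t => e t * e t)).
  { apply (Rmult_le_reg_l (INR T)); [easy|]. eapply Rle_trans; [|exact Hcs].
    rewrite Rabs_mult, Rabs_pos_eq in Hgt by (left; now apply Rinv_0_lt_compat).
    apply (Rmult_lt_compat_l (INR T)) in Hgt; [|easy].
    rewrite <- Rmult_assoc, Rinv_r, Rmult_1_l in Hgt by lra.
    assert (Ha : Rabs (rsum T e) * Rabs (rsum T e) = rsum T e * rsum T e)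
      by (rewrite <- Rabs_mult; apply Rabs_pos_eq, Rle_0_sqr).
    rewrite <- Ha. assert (0 < INR T * eps) by nra. nra. }
  eapply Rle_trans; [apply Rmult_le_compat_l; [|exact Hsq]|].
  - assert (H := exp_pos (-3 * lam)). lra.
  - rewrite <- rsum_scal. apply rsum_le. intros t _. now apply excess_mean_ge.
Qed.

(** Chernoff argument: on a failing path the means are large and the regret is small, so the noise
    sums to at least [a] and exp (s (noise - a)) dominates the failure indicator. The increment
    bound [4 * lam * B] is [2 * lam * B] for the sample plus as much for its mean. *)
Lemma smg_success_prob_ge (m : nat) (A : nat -> nat -> R) (p : nat -> R)
  (lam eta pm eps s a : R) (T : nat) :
  (forall i j, (i < S m)%nat -> (j < S m)%nat -> A i j = A j i) ->
  (forall i, (i < S m)%nat -> rsum (S m) (fun j => Rabs (A i j)) <= lam) ->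
  0 < lam -> (forall j, (j < S m)%nat -> 0 <= p j <= pm) -> pm < 1 ->
  0 < eps -> (0 < T)%nat -> 0 < eta -> eta * grad_bound lam pm <= / 8 -> 0 <= s ->
  a <= exp (-3 * lam) / 2 * (INR T * (eps * eps))
       - (lam * ln (INR (2 * S m - 1)) + INR T * (8 * lam * (eta * grad_bound lam pm) ^ 2)) / eta ->
  1 - exp (INR T * (2 * (s * (4 * lam * grad_bound lam pm) * (s * (4 * lam * grad_bound lam pm))))
           - s * a)
  <= smg_success_prob (S m) A p lam eta eps T.
Proof.
  intros Hs Hrow Hl Hp Hpm Heps HT He HB Hs0 Ha.
  set (B := grad_bound lam pm) in *.
  assert (Hp1 : forall j, (j < S m)%nat -> 0 <= p j < 1)
    by (intros j Hj; specialize (Hp j Hj); lra).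
  assert (HA : rsum m (fun j => Rabs (A m j)) <= lam).
  { specialize (Hrow m ltac:(lia)). simpl in Hrow.
    assert (0 <= Rabs (A m m)) by apply Rabs_pos. lra. }
  set (w := fun f t => smg_iterate (S m) p lam eta f t).
  set (D := fun t f x => miss_mean (S m) A p (excess m A p (w f t)) - excess m A p (w f t) x).
  set (mu := miss_pr (S m) A p).
  set (L := fenum (cube (S m)) (fun _ : nat => 0) T).
  assert (Hmu : forall x, 0 <= mu x) by (intros; now apply miss_pr_nonneg).
  assert (Haz : lsum (fun f => rprod T (fun t => mu (f t)) * exp (s * rsum T (fun t => D t f (f t)))) L
                <= exp (INR T * (2 * (s * (4 * lam * B) * (s * (4 * lam * B)))))).
  { apply azuma_exp_moment.
    - auto.
    - apply miss_pr_total.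
    - intros t f g Hfg. unfold D, w.
      rewrite (smg_iterate_depends (S m) p lam eta t f g Hfg). easy.
    - intros t f Ht Hf.
      destruct (smg_iterate_simplex m p lam eta pm f t) as [Hw Hsum]; try easy; [lra|].
      fold (w f t) in Hw, Hsum.
      assert (Hex : forall x, In x (cube (S m)) ->
                Rabs (excess m A p (w f t) x) <= 2 * lam * B).
      { intros x Hx. apply excess_abs_le; try easy. intros; left; auto. }
      split.
      + unfold D. set (M := miss_mean (S m) A p (excess m A p (w f t))).
        rewrite (lsum_ext_in _ (fun x => M * mu x + -1 * (mu x * excess m A p (w f t) x)))
          by (intros; ring).
        rewrite lsum_plus, !lsum_scal. unfold mu at 1. rewrite miss_pr_total.
        change (lsum (fun x => mu x * excess m A p (w f t) x) (cube (S m))) with M. ring.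
      + intros x Hx. unfold D.
        assert (H1 := miss_mean_abs_le (S m) A p _ _ Hp1 Hex). specialize (Hex x Hx).
        apply Rabs_le_between in H1. apply Rabs_le_between in Hex. apply Rabs_le; lra. }
  assert (Hone : lsum (fun f => rprod T (fun t => mu (f t))) L = 1).
  { unfold L. rewrite (lsum_fenum_rprod (cube (S m)) _ T (fun _ => mu)).
    unfold mu. rewrite miss_pr_total. apply rprod_const1. }
  assert (Hmain : lsum (fun f => rprod T (fun t => mu (f t))) L <=
     smg_success_prob (S m) A p lam eta eps T
     + exp (- (s * a)) * lsum (fun f => rprod T (fun t => mu (f t))
                                   * exp (s * rsum T (fun t => D t f (f t)))) L).
  { unfold smg_success_prob. fold L. fold mu. rewrite <- lsum_scal, <- lsum_plus.
    apply lsum_le_in. intros f Hf.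
    assert (HP : 0 <= rprod T (fun t => mu (f t))) by (apply rprod_nonneg; auto).
    destruct (smg_success _ _ _ _) eqn:Hsucc.
    - assert (H := exp_pos (- (s * a))).
      assert (H' := exp_pos (s * rsum T (fun t => D t f (f t)))).
      assert (0 <= exp (- (s * a)) * (rprod T (fun t => mu (f t)) * exp (s * rsum T (fun t => D t f (f t)))));
        [|lra].
      apply Rmult_le_pos; [lra|]. apply Rmult_le_pos; lra.
    - assert (Hfail := smg_failure_excess m A p lam eta eps T f Hs Hrow Hp1 Heps HT Hsucc).
      assert (Hin : forall t, (t < T)%nat -> In (f t) (cube (S m)))
        by (intros; now apply (fenum_in _ (fun _ : nat => 0) T)).
      assert (Hreg := smg_regret m A p lam eta pm f T Hl Hp Hpm ltac:(lra) HB Hin HA).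
      fold B in Hreg.
      set (Rg := rsum T (fun t => excess m A p (smg_iterate (S m) p lam eta f t) (f t))) in Hreg.
      assert (Hreg' : Rg <= (lam * ln (INR (2 * S m - 1)) + INR T * (8 * lam * (eta * B) ^ 2)) / eta).
      { apply (Rmult_le_reg_l eta); [easy|].
        eapply Rle_trans; [exact Hreg|]. right. field. lra. }
      assert (HD : a <= rsum T (fun t => D t f (f t))).
      { unfold D. rewrite rsum_minus. fold Rg in Hreg'. unfold w. fold Rg. lra. }
      assert (1 <= exp (- (s * a)) * exp (s * rsum T (fun t => D t f (f t)))).
      { rewrite <- exp_plus. rewrite <- exp_0 at 1. apply exp_le_compat. nra. }
      nra. }
  unfold Rminus at 2. rewrite exp_plus, Rmult_comm.
  rewrite Hone in Hmain. assert (Hpos := exp_pos (- (s * a))). nra.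
Qed.

(** * Choice of constants and conclusion *)

(** Since 2n - 1 <= n^2, the regret's log (2n-1) can be absorbed into the log (n/delta) of the
    sample size. *)
Lemma ln_2n_minus_1_le (n : nat) (delta : R) :
  (2 <= n)%nat -> 0 < delta < 1 -> ln (INR (2 * n - 1)) <= 2 * ln (INR n / delta).
Proof.
  intros Hn Hd.
  assert (Hn2 : 2 <= INR n) by (apply (le_INR 2) in Hn; simpl in Hn; lra).
  assert (Hnd : INR n <= INR n / delta).
  { apply (Rmult_le_reg_r delta); [lra|]. unfold Rdiv.
    rewrite Rmult_assoc, Rinv_l by lra. nra. }
  assert (Hlt : ln (INR (2 * n - 1)) < ln (INR n / delta * (INR n / delta))).
  { apply ln_increasing; [apply lt_0_INR; lia|].
    rewrite minus_INR, mult_INR by lia. simpl. nra. }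
  rewrite ln_mult in Hlt by lra. lra.
Qed.

Theorem mainTheorem6 :
  exists K : R, 0 < K /\
  forall (n : nat) (A : nat -> nat -> R) (lam : R) (p : nat -> R)
         (eps delta : R) (T : nat),
    (2 <= n)%nat ->
    (forall i j, (i < n)%nat -> (j < n)%nat -> A i j = A j i) ->
    (forall i, (i < n)%nat -> A i i = 0) ->
    0 < lam ->
    (forall i, (i < n)%nat -> rsum n (fun j => Rabs (A i j)) <= lam) ->
    (forall i, (i < n)%nat -> 0 <= p i < 1) ->
    0 < eps -> 0 < delta < 1 ->
    let pmax := rmax (n - 1) p in
    16 * ln (INR (2 * n - 1)) <= INR T ->
    K * / eps ^ 4 * / (1 - pmax) ^ 4 * exp ((2 / (1 - pmax) + 10) * lam)
      * ln (INR n / delta) <= INR T ->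
    let eta := (1 - pmax) ^ 2 / 2 * exp (- (lam / (1 - pmax)))
               * sqrt (ln (INR (2 * n - 1)) / INR T) in
    1 - delta <= smg_success_prob n A p lam eta eps T.
Proof.
  (* The square of the 30 in [Htau_ge]. *)
  exists 900. split; [lra|].
  intros n A lam p eps delta T Hn Hs _ Hlam Hrow Hp Heps Hdelta pmax HT1 HT2 eta.
  assert (HL2 := ln_2n_minus_1_le n delta Hn Hdelta).
  destruct n as [|m]; [lia|].
  assert (Hpm : pmax < 1) by (apply rmax_lt; intros; apply Hp; lia).
  assert (Hpj : forall j, (j < S m)%nat -> 0 <= p j <= pmax).
  { intros j Hj. split; [now apply Hp|]. apply rmax_ge. lia. }
  set (N := (2 * S m - 1)%nat) in *.
  assert (HlnN : 0 < ln (INR N)).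
  { rewrite <- ln_1. apply ln_increasing; [lra|]. apply (lt_INR 1). unfold N; lia. }
  set (l := ln (INR (S m) / delta)) in *.
  assert (HTp : 0 < INR T) by lra.
  assert (HTn : (0 < T)%nat) by now apply INR_lt.
  set (tau := sqrt (INR T)). set (L := sqrt (ln (INR N))). set (sl := sqrt l).
  assert (Htau : 0 < tau) by now apply sqrt_lt_R0.
  assert (HL : 0 < L) by now apply sqrt_lt_R0.
  assert (Hsl : 0 < sl) by (apply sqrt_lt_R0; lra).
  assert (Etau : tau * tau = INR T) by (apply sqrt_sqrt; lra).
  assert (EL : L * L = ln (INR N)) by (apply sqrt_sqrt; lra).
  assert (Esl : sl * sl = l) by (apply sqrt_sqrt; lra).
  set (q := 1 - pmax) in *. assert (Hq : 0 < q) by (unfold q; lra).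
  set (B := grad_bound lam pmax).
  assert (HB : 0 < B) by now apply grad_bound_pos.
  assert (EB : B = / q ^ 2 * exp (lam / q)) by easy.
  assert (Heta : eta = L / (2 * B * tau)).
  { unfold eta. rewrite sqrt_div by lra. fold L tau. rewrite EB, exp_Ropp.
    assert (H := exp_pos (lam / q)). field. lra. }
  assert (Heta0 : 0 < eta).
  { rewrite Heta. apply Rdiv_lt_0_compat; [easy|]. apply Rmult_lt_0_compat; lra. }
  assert (EetaB : eta * B = L / tau / 2) by (rewrite Heta; field; lra).
  (* This is T >= 16 log (2n-1); it keeps the relative changes of weights within the range of the
     logarithm bound. *)
  assert (HLtau : 4 * L <= tau) by nra.
  assert (HetaB : eta * B <= / 8).
  { rewrite EetaB. apply (Rmult_le_reg_r tau); [easy|].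
    replace (L / tau / 2 * tau) with (L / 2) by (field; lra). lra. }
  (* 3 [lam] repay the curvature factor and 2 [lam] absorb the factor [lam] of regret and noise. *)
  set (e5 := exp (5 * lam)). assert (He5 : 0 < e5) by apply exp_pos.
  assert (Htau_ge : 30 * B * e5 * sl <= eps * eps * tau).
  { set (y := 30 * B * e5 * sl / (eps * eps)).
    assert (Hee : 0 < eps * eps) by nra.
    assert (Hy : 0 < y).
    { apply Rdiv_lt_0_compat; [|easy].
      apply Rmult_lt_0_compat; [|easy]. apply Rmult_lt_0_compat; [lra|easy]. }
    assert (Ey : y * y <= tau * tau).
    { rewrite Etau. eapply Rle_trans; [|exact HT2]. right.
      replace (exp ((2 / q + 10) * lam))
        with (exp (lam / q) * exp (lam / q) * (e5 * e5))
        by (unfold e5; rewrite <- !exp_plus; f_equal; field; lra).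
      rewrite <- Esl. unfold y. rewrite EB. field. lra. }
    assert (Hyt : y <= tau) by nra.
    apply (Rmult_le_compat_l (eps * eps)) in Hyt; [|lra].
    replace (eps * eps * y) with (30 * B * e5 * sl) in Hyt by (unfold y; field; lra). easy. }
  assert (HLsl : 2 * L <= 3 * sl) by nra.
  (* Scaled so that the Azuma term T * 2 (s c)^2, with c = 4 lam B, is exactly [2 * l]. *)
  set (s := sl / (4 * lam * B * tau)).
  assert (HlB : 0 < lam * B) by now apply Rmult_lt_0_compat.
  assert (HlBt : 0 < lam * B * tau) by now apply Rmult_lt_0_compat.
  assert (Hs0 : 0 <= s) by (left; apply Rdiv_lt_0_compat; lra).
  (* In units of lam B tau sl, the signal is at least 30 and the regret, 6 L / sl, is at most 9 by
     [HLsl]. Then s a = 5 l. *)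
  set (a := 20 * (lam * B * tau) * sl).
  assert (Ha : a <= exp (-3 * lam) / 2 * (INR T * (eps * eps))
     - (lam * ln (INR N) + INR T * (8 * lam * (eta * B) ^ 2)) / eta).
  { rewrite EetaB, <- EL, <- Etau, Heta.
    replace ((lam * (L * L) + tau * tau * (8 * lam * (L / tau / 2) ^ 2)) / (L / (2 * B * tau)))
      with (6 * (lam * B * tau) * L) by (field; lra).
    set (e3 := exp (-3 * lam)). assert (He3 : 0 < e3) by apply exp_pos.
    assert (H2 : 2 * lam <= e3 * e5).
    { unfold e3, e5. rewrite <- exp_plus.
      replace (-3 * lam + 5 * lam) with (2 * lam) by ring.
      assert (H := exp_ineq1_le (2 * lam)). lra. }
    assert (H3 : 30 * (lam * B * tau) * sl <= e3 / 2 * (tau * tau * (eps * eps))).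
    { apply Rle_trans with (e3 / 2 * tau * (30 * B * e5 * sl)).
      - assert (0 <= 15 * (B * tau) * sl)
          by (apply Rmult_le_pos; [|lra]; apply Rmult_le_pos; [lra|]; left;
              now apply Rmult_lt_0_compat). nra.
      - replace (e3 / 2 * (tau * tau * (eps * eps))) with (e3 / 2 * tau * (eps * eps * tau)) by ring.
        apply Rmult_le_compat_l; [|easy]. apply Rmult_le_pos; lra. }
    unfold a. nra. }
  eapply Rle_trans;
    [|apply (smg_success_prob_ge m A p lam eta pmax eps s a T); easy].
  fold B.
  (* 2 l from the variance minus 5 l from the deviation; already exp (-l) = delta / n is at most
     [delta]. *)
  replace (INR T * (2 * (s * (4 * lam * B) * (s * (4 * lam * B)))) - s * a) with (- (3 * l)).
  - assert (exp (- (3 * l)) <= delta); [|lra].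
    apply Rle_trans with (exp (- l)); [apply exp_le_compat; lra|].
    assert (HSm : 1 <= INR (S m)) by (apply (le_INR 1); lia).
    assert (Hfrac : 0 < INR (S m) / delta) by (apply Rdiv_lt_0_compat; lra).
    rewrite exp_Ropp. unfold l. rewrite exp_ln by easy.
    replace (/ (INR (S m) / delta)) with (delta * / INR (S m)) by (field; lra).
    assert (/ INR (S m) <= 1) by (rewrite <- Rinv_1; apply Rinv_le_contravar; lra).
    nra.
  - rewrite <- Etau, <- Esl. unfold s, a. field. lra.
Qed.
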